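(* Let $L$ be a BL-algebra, $M_L$ its monoid of good sequences and $(G_L,\preceq)$ its Chang group. Then $(G_L,+,\preceq)$ is a lattice-ordered (Abelian) group, and for all $\mathbf{a},\mathbf{b},\mathbf{c},\mathbf{d}\in M_L$, $$[\mathbf{a},\mathbf{b}]\vee[\mathbf{c},\mathbf{d}]=[(\mathbf{a}+\mathbf{d})\vee(\mathbf{b}+\mathbf{c}),\ \mathbf{b}+\mathbf{d}],\qquad [\mathbf{a},\mathbf{b}]\wedge[\mathbf{c},\mathbf{d}]=[(\mathbf{a}+\mathbf{d})\wedge(\mathbf{b}+\mathbf{c}),\ \mathbf{b}+\mathbf{d}],$$ where the joins and meets on the right are taken in $(M_L,\le)$.
   Context: A BL-algebra is an algebra $(L,\wedge,\vee,\otimes,\to,0,1)$ such that $(L,\wedge,\vee,0,1)$ is a bounded lattice, $(L,\otimes,1)$ is a commutative monoid, $x\otimes y\le z$ iff $x\le y\to z$, $x\wedge y=x\otimes(x\to y)$, and $(x\to y)\vee(y\to x)=1$. Put $\bar x=x\to 0$, $x\oslash y=\bar x\to y$, and $x+y=(x\oslash y)\wedge(y\oslash x)$; this $+$ is commutative and associative with identity $0$. A good sequence of $L$ is a sequence $\mathbf{a}=(a_1,a_2,\ldots)$ of elements of $L$ with $a_i+a_{i+1}=a_i$ for all $i$ and $a_r=0$ for all sufficiently large $r$; $(a_1,\dots,a_n)$ denotes $(a_1,\dots,a_n,0,0,\dots)$. The sum of sequences $\mathbf{a},\mathbf{b}$ is $\mathbf{a}+\mathbf{b}=(c_1,c_2,\ldots)$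 with $c_i=a_i+(a_{i-1}\otimes b_1)+\cdots+(a_1\otimes b_{i-1})+b_i$. $M_L$ is the set of good sequences of $L$; it is closed under this sum, and $(M_L,+,(0))$ is a commutative monoid. $M_L$ is ordered componentwise: $\mathbf{a}\le\mathbf{b}$ iff $a_i\le b_i$ for all $i$; componentwise joins/meets of good sequences are good sequences. The Chang group: on $M_L\times M_L$ set $(\mathbf{a},\mathbf{b})\sim(\mathbf{c},\mathbf{d})$ iff there is $\mathbf{k}\in M_L$ with $\mathbf{a}+\mathbf{d}+\mathbf{k}=\mathbf{b}+\mathbf{c}+\mathbf{k}$; $G_L=(M_L\times M_L)/\sim$, the class of $(\mathbf{a},\mathbf{b})$ is $[\mathbf{a},\mathbf{b}]$, $[\mathbf{a},\mathbf{b}]+[\mathbf{c},\mathbf{d}]=[\mathbf{a}+\mathbf{c},\mathbf{b}+\mathbf{d}]$ (an Abelian group with $-[\mathbf{a},\mathbf{b}]=[\mathbf{b},\mathbf{a}]$ and zero $[(0),(0)]$), and $[\mathbf{a},\mathbf{b}]\preceq[\mathbf{c},\mathbf{d}]$ iff there is $\mathbf{k}\in M_L$ with $\mathbf{a}+\mathbf{d}+\mathbf{k}\le\mathbf{b}+\mathbf{c}+\mathbf{k}$. *)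

(* Defs.v *)
From HB Require Import structures.
From mathcomp Require Import all_boot all_order.
From mathcomp Require Import zify boolp classical_sets.

Set Implicit Arguments.
Unset Strict Implicit.
Unset Printing Implicit Defensive.

Import Order.TTheory.

Declare Scope bl_scope.
Delimit Scope bl_scope with BL.
Local Open Scope order_scope.
Local Open Scope bl_scope.

Reserved Notation "x ~> y" (at level 55, right associativity).

HB.mixin Record isBLAlgebra (d : Order.disp_t) L of Order.TBLattice d L := {
  blmul : L -> L -> L;
  blimp : L -> L -> L;
  blmulA : associative blmul;
  blmulC : commutative blmul;
  blmul1x : left_id \top blmul;
  bladj : forall x y z : L, (blmul x y <= z) = (x <= blimp y z);
  bldiv : forall x y : L, x `&` y = blmul x (blimp x y);
  blprelin : forall x y : L, blimp x y `|` blimp y x = \top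
}.

#[short(type="blAlgType")]
HB.structure Definition BLAlgebra d :=
  { L of isBLAlgebra d L & Order.TBLattice d L }.

Notation "x * y" := (blmul x y) : bl_scope.
Notation "x ~> y" := (blimp x y) : bl_scope.

Definition blneg {d} {L : blAlgType d} (x : L) : L := x ~> \bot.
Definition bloslash {d} {L : blAlgType d} (x y : L) : L := blneg x ~> y.
Definition bladd {d} {L : blAlgType d} (x y : L) : L :=
  bloslash x y `&` bloslash y x.

Notation "x + y" := (bladd x y) : bl_scope.

Section BLTheory.
Context {d : Order.disp_t} {L : blAlgType d}.
Implicit Types x y z u v : L.
Local Notation neg := (@blneg d L).

Lemma blmulx1 x : x * \top = x. Proof. by rewrite blmulC blmul1x. Qed.

Lemma blmulAC x y z : x * y * z = x * z * y.
Proof. by rewrite -!blmulA (blmulC y). Qed.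

Lemma blmp x y : x * (x ~> y) <= y.
Proof. by rewrite blmulC bladj. Qed.

Lemma blmul_le2 x y u v : x <= y -> u <= v -> x * u <= y * v.
Proof.
move=> xy uv; apply: (@le_trans _ _ (y * u)).
  by rewrite bladj (le_trans xy) // -bladj.
by rewrite blmulC bladj (le_trans uv) // -bladj blmulC.
Qed.

Lemma blmul_lel x y : x * y <= x.
Proof. by rewrite -[leRHS]blmulx1 blmul_le2 ?lex1. Qed.

Lemma blmul_ler x y : x * y <= y.
Proof. by rewrite blmulC blmul_lel. Qed.

Lemma blimp_eq1 x y : (x ~> y == \top) = (x <= y).
Proof. by rewrite -le1x -bladj blmul1x. Qed.

Lemma blimp1 x y : x <= y -> x ~> y = \top.
Proof. by move=> xy; apply/eqP; rewrite blimp_eq1. Qed.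

Lemma bl1imp x : \top ~> x = x.
Proof.
apply/le_anti/andP; split; last by rewrite -bladj blmulx1.
by have := blmp \top x; rewrite blmul1x.
Qed.

Lemma blimpM x y z : (x * y) ~> z = x ~> (y ~> z).
Proof.
apply/le_anti/andP; split.
  by rewrite -!bladj -blmulA blmulC blmp.
by rewrite -bladj blmulA !bladj.
Qed.

Lemma blimpC x y z : x ~> (y ~> z) = y ~> (x ~> z).
Proof. by rewrite -!blimpM blmulC. Qed.

Lemma blimp_le2 x y u v : y <= x -> u <= v -> x ~> u <= y ~> v.
Proof.
move=> yx uv; rewrite -bladj (le_trans _ uv) //.
by rewrite blmulC (le_trans _ (blmp x u)) // blmul_le2.
Qed.

Lemma blle_imp x y : y <= x ~> y.
Proof. by rewrite -bladj blmul_lel. Qed.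

Lemma blmul0x x : \bot * x = \bot.
Proof. by apply/eqP; rewrite -lex0 blmul_lel. Qed.

Lemma blmulx0 x : x * \bot = \bot.
Proof. by rewrite blmulC blmul0x. Qed.

Lemma blmul_joinr x y z : x * (y `|` z) = (x * y) `|` (x * z).
Proof.
apply/le_anti/andP; split; last first.
  by rewrite leUx !blmul_le2 // ?leUl ?leUr.
by rewrite blmulC bladj leUx -!bladj !(blmulC _ x) leUl leUr.
Qed.

Lemma blle_neg2 x : x <= neg (neg x).
Proof. by rewrite -bladj blmp. Qed.

Lemma blneg_le x y : x <= y -> neg y <= neg x.
Proof. by move=> xy; apply: (blimp_le2 xy). Qed.

Lemma blneg3 x : neg (neg (neg x)) = neg x.
Proof.
by apply/le_anti/andP; split; [apply/blneg_le/blle_neg2 | apply/blle_neg2].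
Qed.

Lemma blneg0 : neg \bot = \top. Proof. exact: blimp1. Qed.

Lemma blneg1 : neg \top = \bot. Proof. exact: bl1imp. Qed.

Lemma blnegM x y : neg (x * y) = x ~> neg y.
Proof. exact: blimpM. Qed.

Lemma blmul_neg x : x * neg x = \bot.
Proof. by apply/eqP; rewrite -lex0 blmp. Qed.

Lemma blneg_eq1 x : (neg x == \top) = (x == \bot).
Proof. by rewrite blimp_eq1 lex0. Qed.

Lemma bladdC x y : x + y = y + x.
Proof. exact: meetC. Qed.

Lemma bladd0x x : \bot + x = x.
Proof.
rewrite /bladd /bloslash blneg0 bl1imp; apply/meet_idPl; exact: blle_neg2.
Qed.

Lemma bladdx0 x : x + \bot = x.
Proof. by rewrite bladdC bladd0x. Qed.

Lemma bladd1x x : \top + x = \top.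
Proof. by rewrite /bladd /bloslash blneg1 !blimp1 ?le0x ?lex1 // meetxx. Qed.

Lemma bladd_le2 x y u v : x <= y -> u <= v -> x + u <= y + v.
Proof.
by move=> xy uv; apply: leI2; apply: blimp_le2 => //; apply: blneg_le.
Qed.

Lemma blle_addl x y : x <= x + y.
Proof. by rewrite -[leLHS]bladdx0 bladd_le2 ?le0x. Qed.

End BLTheory.

(* Sequences are indexed from 0: [a n] is the entry written a_{n+1} in the usual
   1-based notation, so [seq_add a b n] is
   a_{n+1} + (a_n * b_1) + ... + (a_1 * b_n) + b_{n+1}. *)
Definition seq_add {d} {L : blAlgType d} (a b : nat -> L) : nat -> L :=
  fun n => a n + \big[bladd / \bot]_(j < n) (a (n - j.+1)%N * b j) + b n.

Definition good_seq {d} {L : blAlgType d} (a : nat -> L) : Prop :=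
  (forall i, a i + a i.+1 = a i) /\
  exists r, forall i, (r <= i)%N -> a i = \bot.

Section Chain.
Context {d : Order.disp_t} {L : blAlgType d}.
Hypothesis tot : forall x y : L, x <= y \/ y <= x.
Implicit Types x y z u v : L.
Local Notation neg := (@blneg d L).

Lemma chain_meet x y : x `&` y = x \/ x `&` y = y.
Proof. by case: (tot x y) => [xy|yx]; [left; apply: meet_l|right; apply: meet_r]. Qed.

Lemma chain_reg x : neg x = \bot \/ neg (neg x) = x.
Proof.
have [|w0] := eqVneq (neg x) \bot; [by left | right].
set z := neg (neg x); set w := neg x in w0 *; set e := z ~> x.
have xz : x <= z := blle_neg2 x.
have eE : z * e = x by rewrite /e -bldiv meet_r.
have nw : neg z = w by rewrite /z blneg3.
have ne : neg e = \bot.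
  have nez : neg e <= z.
    have : neg z <= e by apply: blimp_le2; rewrite ?le0x.
    by rewrite nw => /blneg_le.
  have E : neg e = z * (z ~> neg e) by rewrite -bldiv meet_r.
  by rewrite E -blnegM eE -/w -nw blmul_neg.
have we : w <= e.
  case: (tot w e) => // /blneg_le; rewrite ne lex0 => /eqP z0.
  by have := le_trans (blle_neg2 x) (eqbRL (lex0 _) (introT eqP z0));
     rewrite lex0 => /eqP x0; rewrite /e x0 /z /w x0 blneg0 blneg1 blimp1 ?lex1.
have wE : w = e * (e ~> w) by rewrite -bldiv meet_r.
set s := e ~> w in wE.
have zE : z = e ~> neg s by rewrite /z -/w {1}wE blnegM.
have : x = e `&` neg s by rewrite bldiv -zE blmulC eE.
case: (chain_meet e (neg s)) => -> xE.
  by move: w0; rewrite /w xE ne eqxx.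
by rewrite /z /w xE blneg3.
Qed.

Lemma chain_addE x y : x != \bot -> y != \bot -> x + y = neg (neg x * neg y).
Proof.
have dense u v : neg u = \bot -> v != \bot -> neg v ~> u = \top.
  move=> u0 v0; apply: blimp1; case: (tot (neg v) u) => // /blneg_le.
  rewrite u0 lex0 => /eqP vv; case/negP: v0.
  by rewrite -lex0 -vv blle_neg2.
move=> x0 y0; rewrite blnegM /bladd /bloslash.
case: (chain_reg x) => [nx|xx].
  by rewrite (dense x y) // nx !blimp1 ?le0x // meetxx.
case: (chain_reg y) => [ny|yy].
  by rewrite (dense y x) // ny blneg0 !blimp1 ?le0x ?lex1 // meetxx.
rewrite yy -[neg y ~> x](_ : neg x ~> y = _) ?meetxx //.
by rewrite -{1}yy -{2}xx /blneg blimpC.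
Qed.

Lemma chain_addA : associative (@bladd d L).
Proof.
move=> x y z.
have [->|x0] := eqVneq x \bot; first by rewrite !bladd0x.
have [->|y0] := eqVneq y \bot; first by rewrite bladd0x bladdx0.
have [->|z0] := eqVneq z \bot; first by rewrite !bladdx0.
have n0 u v : u != \bot -> u + v != \bot.
  by apply: contra_neq => uv; apply/eqP; rewrite -lex0 -uv blle_addl.
rewrite (@chain_addE x) ?(@chain_addE y z) ?(@chain_addE _ z) ?(@chain_addE x y);
  rewrite ?n0 //; last by rewrite -(chain_addE y0 z0) n0.
have D u v : neg (u * neg (neg v)) = neg (u * v) by rewrite !blnegM blneg3.
by rewrite D (blmulC (neg (neg _))) D blmulA blmulC.
by rewrite -chain_addE ?n0.
Qed.

Lemma chain_good x y : x + y = x -> x = \top \/ y = \bot.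
Proof.
have [->|y0] := eqVneq y \bot; first by right.
have [->|x0] := eqVneq x \bot; first by rewrite bladd0x; right.
rewrite chain_addE // => xE; left.
have xx : neg (neg x) = x by rewrite -xE blneg3.
have yxE : neg y ~> x = x by rewrite -{2}xE blmulC blnegM xx.
case: (tot (neg y) x) => [yx|/blneg_le yx].
  by rewrite -yxE blimp1.
have E : neg x `&` neg (neg y) = \bot.
  by rewrite bldiv -blnegM xE blmulC blmul_neg.
case/negP: y0; rewrite -lex0 -E lexI blle_neg2 andbT.
exact: le_trans (blle_neg2 y) yx.
Qed.

Lemma chain_add_mul x y : x + y = \top \/ x * y = \bot.
Proof.
have [->|y0] := eqVneq y \bot; first by right; rewrite blmulx0.
have [->|x0] := eqVneq x \bot; first by right; rewrite blmul0x.
case: (tot x (neg y)) => [xy|yx].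
  by right; apply/eqP; rewrite -lex0 bladj.
left; rewrite chain_addE // blmulC blnegM blimp1 //.
exact: le_trans yx (blle_neg2 x).
Qed.

Lemma chain_join_good x x' y y' :
  x + x' = x -> y + y' = y -> (x `|` y) + (x' `|` y') = x `|` y.
Proof.
move=> /chain_good [-> _|-> /chain_good [->|->]].
- by rewrite join1x bladd1x.
- by rewrite joinx1 bladd1x.
- by rewrite join0x bladdx0.
Qed.

Lemma chain_shape (a : nat -> L) : good_seq a ->
  exists p x, forall i, a i =
    if (i < p)%N then \top else if i == p then x else \bot.
Proof.
move=> [ga [r]]; elim: r a ga => [|r IH] a ga ar.
  by exists 0%N, \bot => i; rewrite ar //; case: eqP.
have [|p [x E]] := IH (fun i => a i.+1) (fun i => ga i.+1).
  by move=> i ri; apply: ar.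
case: (chain_good (ga 0%N)) => [a0|a1].
  by exists p.+1, x => -[|i] //; rewrite E ltnS eqSS.
exists 0%N, (a 0%N) => -[|i] //=.
by elim: i => // i IHi; have := ga i.+1; rewrite IHi bladd0x.
Qed.

End Chain.

Section Filter.
Context {d : Order.disp_t} {L : blAlgType d}.
Implicit Types x y z u v t : L.

Definition bl_filter (F : set L) :=
  [/\ F \top, forall x y, F x -> x <= y -> F y & forall x y, F x -> F y -> F (x * y)].

Definition bl_prime (F : set L) :=
  bl_filter F /\ forall x y, F (x ~> y) \/ F (y ~> x).

Definition blpow x n := iter n (blmul x) \top.

Lemma blpowD x n m : blpow x (n + m)%N = blpow x n * blpow x m.
Proof. by elim: n => [|n IH]; rewrite ?blmul1x // addSn /= IH blmulA. Qed.

Lemma bljoin_pow x y n : x `|` y = \top -> blpow x n `|` y = \top.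
Proof.
move=> xy; elim: n => [|n IH]; first by rewrite join1x.
apply/eqP; rewrite -le1x -[leLHS](blmul1x (\top : L)) -{1}xy -{1}IH.
rewrite blmul_joinr leUx [X in _ && X](le_trans (blmul_ler _ _)) ?leUr // andbT.
rewrite blmulC blmul_joinr leUx blmulC leUl /=.
by rewrite (le_trans (blmul_ler _ _)) ?leUr.
Qed.

Lemma bl_prime_sep t : t != \top -> exists2 F, bl_prime F & ~ F t.
Proof.
move=> t1; pose P (F : set L) := [/\ forall x y, F x -> x <= y -> F y,
  forall x y, F x -> F y -> F (x * y) & ~ F t].
have [|F [[Fup Fmul Ft] Fmax]] := @Zorn_bigcup L P.
  move=> C CP Ctot; split.
  - by move=> x y [X CX Xx] xy; exists X => //; have [+ _ _] := CP _ CX; apply; eauto.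
  - move=> x y [X CX Xx] [Y CY Yy].
    case: (Ctot X Y CX CY) => [XY|YX].
      by exists Y => //; have [_ + _] := CP _ CY; apply => //; apply: XY.
    by exists X => //; have [_ + _] := CP _ CX; apply => //; apply: YX.
  - by move=> [X CX]; have [] := CP _ CX.
have F1 : F \top.
  apply: contrapT => nF1; apply: (Fmax [set \top]%classic).
    split; last by move=> /(_ \top erefl).
    by move=> x Fx; case: nF1; apply: Fup Fx (lex1 _).
  split=> [x y -> | x y -> -> | /esym/eqP]; last by rewrite eq_sym (negbTE t1).
  - by rewrite le1x => /eqP.
  - by rewrite blmul1x.
have ext s : ~ F s -> exists f n, F f /\ f * blpow s n <= t.
  move=> nFs; apply: contrapT => H.
  pose G : set L := [set z | exists f n, F f /\ f * blpow s n <= z]%classic.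
  apply: (Fmax G).
    split=> [x Fx|GF]; first by exists x, 0%N; rewrite /= blmulx1.
    by apply/nFs/GF; exists \top, 1%N; split => //; rewrite /= blmul1x blmulx1.
  split=> // [x y [f [n [Ff fx]]] xy|x y [f [n [Ff fx]]] [g [m [Fg gy]]]].
    by exists f, n; split => //; apply: le_trans xy.
  exists (f * g), (n + m)%N; split; first exact: Fmul.
  rewrite blpowD -blmulA (blmulA g) (blmulC g) -blmulA blmulA.
  exact: blmul_le2.
exists F => //; split => // x y.
apply: contrapT => /not_orP[/ext[f [n [Ff fn]]] /ext[g [m [Fg gm]]]].
apply: Ft; apply: (Fup (f * g)); first exact: Fmul.
rewrite -[leLHS]blmulx1.
have <- : blpow (x ~> y) n `|` blpow (y ~> x) m = \top.
  by apply: bljoin_pow; rewrite joinC; apply: bljoin_pow; rewrite joinC blprelin.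
rewrite blmul_joinr leUx -{1}blmulA (blmulC g) blmulA.
rewrite (le_trans (blmul_lel _ _)) //= -blmulA.
exact: le_trans (blmul_ler _ _) gm.
Qed.

End Filter.

Section Quotient.
Context {d : Order.disp_t} {L : blAlgType d}.
Variables (F : set L) (Fp : bl_prime F).
Implicit Types x y z : L.

Let F1 : F \top. Proof. by case: Fp => -[]. Qed.
Let Fup x y : F x -> x <= y -> F y. Proof. by case: Fp => -[_ + _ _]; exact. Qed.
Let FM x y : F x -> F y -> F (x * y). Proof. by case: Fp => -[_ _ + _]; exact. Qed.
Let Ftrans x y z : F (x ~> y) -> F (y ~> z) -> F (x ~> z).
Proof.
move=> xy yz; apply: Fup (FM xy yz) _; rewrite -bladj blmulAC.
apply: le_trans (blmp y z); apply: blmul_le2 => //.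
by rewrite blmulC blmp.
Qed.
Let Fle x y : x <= y -> F (x ~> y). Proof. by move=> /blimp1->. Qed.

Definition bl_cong x y := `[< F (x ~> y) /\ F (y ~> x) >].

Lemma bl_cong_equiv : equiv_class_of bl_cong.
Proof.
split=> [x|x y|y x z]; first by apply/asboolP; split; apply: Fle.
  by apply/asboolP/asboolP => -[].
move=> /asboolP[xy yx] /asboolP[yz zy]; apply/asboolP.
by split; [apply: Ftrans yz|apply: Ftrans yx].
Qed.

Canonical bl_cong_rel := EquivRelPack bl_cong_equiv.

Definition bl_quot := {eq_quot bl_cong_rel}%qT.
Local Notation Q := bl_quot.
HB.instance Definition _ := Choice.on Q.
HB.instance Definition _ := EqQuotient.on Q.

Definition bl_pi x : Q := (\pi x)%qT.

Lemma bl_pi_eq x y : F (x ~> y) -> F (y ~> x) -> bl_pi x = bl_pi y.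
Proof. by move=> xy yx; apply/eqquotP/asboolP. Qed.

Lemma bl_pi_eqP x y : bl_pi x = bl_pi y -> F (x ~> y) /\ F (y ~> x).
Proof. by move=> /eqquotP/asboolP. Qed.

Lemma bl_piK X : bl_pi (repr X) = X.
Proof. exact: reprK. Qed.

Definition quot_le (X Y : Q) := `[< F (repr X ~> repr Y) >].
Definition quot_lt (X Y : Q) := (Y != X) && quot_le X Y.

Lemma quot_leE x y : quot_le (bl_pi x) (bl_pi y) = `[< F (x ~> y) >].
Proof.
have [x1 x2] := bl_pi_eqP (bl_piK (bl_pi x)).
have [y1 y2] := bl_pi_eqP (bl_piK (bl_pi y)).
by apply/asboolP/asboolP => H;
  [apply: Ftrans x2 (Ftrans H y1)|apply: Ftrans x1 (Ftrans H y2)].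
Qed.

Lemma quot_le_anti : antisymmetric quot_le.
Proof.
move=> X Y; rewrite -(bl_piK X) -(bl_piK Y) !quot_leE.
by move=> /andP[/asboolP ? /asboolP ?]; apply: bl_pi_eq.
Qed.

Lemma quot_le_trans : transitive quot_le.
Proof. by move=> Y X Z /asboolP XY /asboolP YZ; apply/asboolP; exact: Ftrans YZ. Qed.

Lemma quot_le_total : total quot_le.
Proof.
move=> X Y; case: Fp => _ /(_ (repr X) (repr Y)).
by case=> ?; apply/orP; [left|right]; apply/asboolP.
Qed.

HB.instance Definition _ := @Order.isOrder.Build d Q quot_le quot_lt
  (fun X Y => if quot_lt X Y then X else Y)
  (fun X Y => if quot_lt X Y then Y else X)
  (fun _ _ => erefl) (fun _ _ => erefl) (fun _ _ => erefl)
  quot_le_anti quot_le_trans quot_le_total.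

Lemma bl_pi_le x y : (bl_pi x <= bl_pi y) = `[< F (x ~> y) >].
Proof. exact: quot_leE. Qed.

Lemma bl_pi_mono x y : x <= y -> bl_pi x <= bl_pi y.
Proof. by rewrite bl_pi_le => /Fle ?; apply/asboolP. Qed.

Lemma quot_bot (X : Q) : bl_pi \bot <= X.
Proof. by rewrite -(bl_piK X) bl_pi_mono ?le0x. Qed.
Lemma quot_top (X : Q) : X <= bl_pi \top.
Proof. by rewrite -(bl_piK X) bl_pi_mono ?lex1. Qed.

HB.instance Definition _ := @Order.hasBottom.Build d Q (bl_pi \bot) quot_bot.
HB.instance Definition _ := @Order.hasTop.Build d Q (bl_pi \top) quot_top.

Definition quot_mul (X Y : Q) : Q := bl_pi (repr X * repr Y).
Definition quot_imp (X Y : Q) : Q := bl_pi (repr X ~> repr Y).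

Lemma quot_mulE x y : quot_mul (bl_pi x) (bl_pi y) = bl_pi (x * y).
Proof.
have M u u' v v' : F (u ~> u') -> F (v ~> v') -> F (u * v ~> u' * v').
  move=> uu vv; apply: Fup (FM uu vv) _; rewrite -bladj.
  rewrite -blmulA (blmulA (v ~> v')) (blmulC (v ~> v')) -blmulA blmulA.
  by rewrite blmul_le2 // blmulC blmp.
have [x1 x2] := bl_pi_eqP (bl_piK (bl_pi x)).
have [y1 y2] := bl_pi_eqP (bl_piK (bl_pi y)).
by apply: bl_pi_eq; apply: M.
Qed.

Lemma quot_impE x y : quot_imp (bl_pi x) (bl_pi y) = bl_pi (x ~> y).
Proof.
have M u u' v v' : F (u' ~> u) -> F (v ~> v') -> F ((u ~> v) ~> (u' ~> v')).
  move=> uu vv; apply: Fup (FM uu vv) _; rewrite -!bladj.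
  rewrite (blmulC _ u') !blmulA (blmulAC _ (v ~> v')).
  apply: le_trans (blmp v v'); apply: blmul_le2 => //.
  by apply: le_trans (blmp u v); apply: blmul_le2 => //; apply: blmp.
have [x1 x2] := bl_pi_eqP (bl_piK (bl_pi x)).
have [y1 y2] := bl_pi_eqP (bl_piK (bl_pi y)).
by apply: bl_pi_eq; apply: M.
Qed.

Lemma bl_pi_meet x y : bl_pi (x `&` y) = bl_pi x `&` bl_pi y.
Proof.
have M (u v : L) : u ~> v <= u ~> (u `&` v).
  by rewrite -bladj lexI blmul_ler blmulC blmp.
have [xy|/ltW yx] := leP (bl_pi x) (bl_pi y).
  apply/le_anti; rewrite bl_pi_mono ?leIl //= bl_pi_le.
  by move: xy; rewrite bl_pi_le => /asboolP /Fup /(_ (M _ _)) ?; apply/asboolP.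
apply/le_anti; rewrite bl_pi_mono ?leIr //= bl_pi_le meetC.
by move: yx; rewrite bl_pi_le => /asboolP /Fup /(_ (M _ _)) ?; apply/asboolP.
Qed.

Lemma bl_pi_join x y : bl_pi (x `|` y) = bl_pi x `|` bl_pi y.
Proof.
have M (u v : L) : u ~> v <= (u `|` v) ~> v.
  by rewrite -bladj blmul_joinr leUx blmul_ler blmulC blmp.
have [xy|/ltW yx] := leP (bl_pi x) (bl_pi y).
  apply/le_anti; rewrite andbC bl_pi_mono ?leUr //= bl_pi_le.
  by move: xy; rewrite bl_pi_le => /asboolP /Fup /(_ (M _ _)) ?; apply/asboolP.
apply/le_anti; rewrite andbC bl_pi_mono ?leUl //= bl_pi_le joinC.
by move: yx; rewrite bl_pi_le => /asboolP /Fup /(_ (M _ _)) ?; apply/asboolP.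
Qed.

Fact quot_mulA : associative quot_mul.
Proof.
move=> X Y Z; rewrite -(bl_piK X) -(bl_piK Y) -(bl_piK Z).
by rewrite !quot_mulE blmulA.
Qed.

Fact quot_mulC : commutative quot_mul.
Proof. by move=> X Y; rewrite /quot_mul blmulC. Qed.

Fact quot_mul1x : left_id (\top : Q) quot_mul.
Proof. by move=> X; rewrite -(bl_piK X) quot_mulE blmul1x. Qed.

Fact quot_adj (X Y Z : Q) : (quot_mul X Y <= Z) = (X <= quot_imp Y Z).
Proof.
rewrite -(bl_piK X) -(bl_piK Y) -(bl_piK Z) quot_mulE quot_impE !bl_pi_le.
by rewrite blimpM.
Qed.

Fact quot_div (X Y : Q) : X `&` Y = quot_mul X (quot_imp X Y).
Proof.
by rewrite -(bl_piK X) -(bl_piK Y) quot_impE quot_mulE -bl_pi_meet bldiv.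
Qed.

Fact quot_prelin (X Y : Q) : quot_imp X Y `|` quot_imp Y X = \top.
Proof.
by rewrite -(bl_piK X) -(bl_piK Y) !quot_impE -bl_pi_join blprelin.
Qed.

HB.instance Definition _ := @isBLAlgebra.Build d Q quot_mul quot_imp
  quot_mulA quot_mulC quot_mul1x quot_adj quot_div quot_prelin.

Lemma quot_tot (X Y : Q) : X <= Y \/ Y <= X.
Proof. by apply/orP; rewrite le_total. Qed.

Lemma bl_pi_add x y : bl_pi (x + y) = (bl_pi x + bl_pi y : Q).
Proof. by rewrite bl_pi_meet -!quot_impE. Qed.

Lemma bl_pi_seq_add a b n :
  bl_pi (seq_add a b n) = seq_add (bl_pi \o a) (bl_pi \o b) n.
Proof.
rewrite /seq_add !bl_pi_add; congr (_ + _ + _).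
elim/big_rec2: _ => // j x y _ <-.
by rewrite bl_pi_add -quot_mulE.
Qed.

Lemma bl_pi_good (a : nat -> L) : good_seq a -> good_seq (bl_pi \o a : nat -> Q).
Proof.
move=> [ga [r ar]]; split=> [i|]; first by rewrite /= -bl_pi_add ga.
by exists r => i /ar /= ->.
Qed.

End Quotient.

Section SeqAdd.
Context {d : Order.disp_t} {L : blAlgType d}.
Implicit Types (x y z : L) (a b : nat -> L).

Lemma bl_ext x y :
  (forall F (Fp : bl_prime F), bl_pi Fp x = bl_pi Fp y) -> x = y.
Proof.
move=> E; apply/le_anti/andP; split; rewrite -blimp_eq1; apply/eqP;
  apply: contrapT => /eqP /bl_prime_sep[F Fp]; apply;
  by have [] := bl_pi_eqP (E F Fp).
Qed.

Lemma bladdA : associative (@bladd d L).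
Proof.
move=> x y z; apply: bl_ext => F Fp; rewrite !bl_pi_add.
exact: (chain_addA (@quot_tot _ _ _ Fp)).
Qed.

HB.instance Definition _ :=
  Monoid.isComLaw.Build L \bot (@bladd d L) bladdA bladdC bladd0x.

Definition seq_ext a n := if n is m.+1 then a m else \top.

Lemma seq_addE a b n :
  seq_add a b n =
  \big[bladd / \bot]_(j < n.+2) (seq_ext a (n.+1 - j)%N * seq_ext b j).
Proof.
rewrite big_ord_recl big_ord_recr /= /bump add1n subnn blmulx1 blmul1x bladdA.
congr (_ + _ + _); apply: eq_bigr => j _; rewrite leq0n add1n subSS.
by rewrite -(subnSK (ltn_ord j)).
Qed.

Lemma chain_seq_add (tot : forall x y : L, x <= y \/ y <= x) a b i :
  good_seq a -> good_seq b ->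
  seq_add a b i + seq_add a b i.+1 = seq_add a b i.
Proof.
move=> /(chain_shape tot)[p [x aE]] /(chain_shape tot)[q [y bE]].
have extE c r z : (forall i, c i =
    if (i < r)%N then \top else if i == r then z else \bot) -> forall i,
    seq_ext c i = if (i <= r)%N then \top else if i == r.+1 then z else \bot.
  by move=> cE [|n] //=; rewrite cE eqSS.
have {}aE := extE _ _ _ aE; have {}bE := extE _ _ _ bE.
have one n : (n < p + q)%N -> seq_add a b n = \top.
  move=> npq; rewrite seq_addE.
  have jP : (minn q n.+1 < n.+2)%N by rewrite ltnS geq_minr.
  rewrite (bigD1 (Ordinal jP)) //= aE bE geq_minl.
  rewrite (_ : (n.+1 - _ <= p)%N) ?blmul1x ?bladd1x //.
  by rewrite leq_subLR minnE; lia.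
have zero n : (p + q < n)%N -> seq_add a b n.+1 = \bot.
  move=> npq; rewrite seq_addE big1 // => j _; rewrite aE bE.
  have [jq|qj] := leqP j q.
    by rewrite leqNgt ifF ?ifF ?blmul0x //; lia.
  by have [->|jq] := eqVneq (j : nat) q.+1; rewrite ?blmulx0 // ?ifF ?ifF ?blmul0x //; lia.
case: (ltngtP i (p + q)) => ipq; first by rewrite one // bladd1x.
  by rewrite zero // bladdx0.
subst i; case: (chain_add_mul tot x y) => [xy|xy].
  rewrite (_ : seq_add a b (p + q)%N = \top) ?bladd1x //.
  rewrite seq_addE.
  have j1 : (q < (p + q).+2)%N by lia.
  have j2 : (q.+1 < (p + q).+2)%N by lia.
  rewrite (bigD1 (Ordinal j1)) //= (bigD1 (Ordinal j2)) /=; last first.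
    by rewrite -val_eqE /= gtn_eqF.
  have -> : b q = y by have := bE q.+1; rewrite /= ltnn eqxx.
  have [-> ->] : (p + q).+1 - q = p.+1 /\ (p + q).+1 - q.+1 = p by lia.
  rewrite bladdA !aE !bE ltnn eqxx !leqnn.
  by rewrite blmulx1 blmul1x xy bladd1x.
rewrite [X in _ + X](_ : _ = \bot) ?bladdx0 //.
rewrite seq_addE big1 // => j _; rewrite aE bE.
have [jq|qj] := leqP j q; first by rewrite ifF ?ifF ?blmul0x //; lia.
have [->|jq] := eqVneq (j : nat) q.+1; last by rewrite blmulx0.
by rewrite ifF ?ifT //; lia.
Qed.

End SeqAdd.

Section Closure.
Context {d : Order.disp_t} {L : blAlgType d}.
Implicit Types a b : nat -> L.

Lemma good_seq0 : good_seq (fun _ => \bot : L).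
Proof. by split=> [i|]; [rewrite bladd0x|exists 0%N]. Qed.

Lemma good_seq_meet a b :
  good_seq a -> good_seq b -> good_seq (fun i => a i `&` b i).
Proof.
move=> [ga [r ar]] [gb _]; split=> [i|].
  apply/le_anti; rewrite blle_addl andbT lexI.
  rewrite -[in X in _ <= X](ga i) -[in X in _ && (_ <= X)](gb i).
  by rewrite !bladd_le2 ?leIl ?leIr.
by exists r => i /ar ->; rewrite meet0x.
Qed.

Lemma good_seq_join a b :
  good_seq a -> good_seq b -> good_seq (fun i => a i `|` b i).
Proof.
move=> [ga [r ar]] [gb [s bs]]; split=> [i|].
  apply: bl_ext => F Fp; rewrite bl_pi_add !bl_pi_join.
  by apply: (chain_join_good (@quot_tot _ _ _ Fp)); rewrite -bl_pi_add ?ga ?gb.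
exists (maxn r s) => i; rewrite geq_max => /andP[/ar -> /bs ->].
by rewrite join0x.
Qed.

Lemma good_seq_add a b : good_seq a -> good_seq b -> good_seq (seq_add a b).
Proof.
move=> ga gb; split=> [i|].
  apply: bl_ext => F Fp; rewrite bl_pi_add !bl_pi_seq_add.
  exact: (chain_seq_add (@quot_tot _ _ _ Fp) _ (bl_pi_good Fp ga) (bl_pi_good Fp gb)).
case: ga gb => [_ [r ar]] [_ [s bs]]; exists (r + s).+1 => n rsn.
rewrite /seq_add ar ?bs ?big1 ?bladdx0 //; try lia.
move=> j _; have [sj|js] := leqP s j; first by rewrite bs ?blmulx0.
by rewrite ar ?blmul0x //; lia.
Qed.

End Closure.

Record good (d : Order.disp_t) (L : blAlgType d) :=
  Good { good_val :> nat -> L; goodP : good_seq good_val }.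
Arguments Good {d L}.
Arguments goodP {d L}.

HB.instance Definition _ d (L : blAlgType d) := gen_eqMixin (good L).
HB.instance Definition _ d (L : blAlgType d) := gen_choiceMixin (good L).

Section Good.
Context {d : Order.disp_t} {L : blAlgType d}.
Local Notation M := (good L).
Implicit Types a b c : M.

Lemma good_ext a b : (forall i, a i = b i) -> a = b.
Proof.
case: a b => [a ga] [b gb] /= /funext E; case: _ / E gb => gb.
by congr Good; apply: Prop_irrelevance.
Qed.

Definition good_zero : M := Good _ good_seq0.
Definition good_add a b : M := Good _ (good_seq_add (goodP a) (goodP b)).

Definition good_le a b : bool := `[< forall i, a i <= b i >].
Definition good_meet a b : M := Good _ (good_seq_meet (goodP a) (goodP b)).
Definition good_join a b : M := Good _ (good_seq_join (goodP a) (goodP b)).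

Fact good_le_refl : reflexive good_le.
Proof. by move=> a; apply/asboolP => i. Qed.

Fact good_le_anti : antisymmetric good_le.
Proof.
move=> a b /andP[/asboolP ab /asboolP ba]; apply: good_ext => i.
by apply/le_anti; rewrite ab ba.
Qed.

Fact good_le_trans : transitive good_le.
Proof.
move=> b a c /asboolP ab /asboolP bc; apply/asboolP => i.
exact: le_trans (ab i) (bc i).
Qed.

Fact good_meetC : commutative good_meet.
Proof. by move=> a b; apply: good_ext => i; apply: meetC. Qed.
Fact good_joinC : commutative good_join.
Proof. by move=> a b; apply: good_ext => i; apply: joinC. Qed.
Fact good_meetA : associative good_meet.
Proof. by move=> a b c; apply: good_ext => i; apply: meetA. Qed.
Fact good_joinA : associative good_join.
Proof. by move=> a b c; apply: good_ext => i; apply: joinA. Qed.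
Fact good_joinKI b a : good_meet a (good_join a b) = a.
Proof. by apply: good_ext => i; apply: joinKI. Qed.
Fact good_meetKU b a : good_join a (good_meet a b) = a.
Proof. by apply: good_ext => i; apply: meetKU. Qed.
Fact good_leEmeet a b : good_le a b = (good_meet a b == a).
Proof.
apply/asboolP/eqP => [ab|<- i]; last exact: leIr.
by apply: good_ext => i; apply/meet_idPl/ab.
Qed.

HB.instance Definition _ := @Order.Le_isPOrder.Build d M good_le
  good_le_refl good_le_anti good_le_trans.
HB.instance Definition _ := @Order.POrder_isLattice.Build d M good_meet good_join
  good_meetC good_joinC good_meetA good_joinA good_joinKI good_meetKU
  good_leEmeet.

Lemma good_leP a b : (a <= b) <-> (forall i, a i <= b i).
Proof. by split=> [/asboolP|/asboolP]. Qed.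

Lemma good_joinE a b i : (a `|` b) i = a i `|` b i. Proof. by []. Qed.
Lemma good_meetE a b i : (a `&` b) i = a i `&` b i. Proof. by []. Qed.

End Good.

Notation "a +M b" := (good_add a b) (at level 50, left associativity) : bl_scope.

Section ChangGroup.
Context {d : Order.disp_t} {L : blAlgType d}.
Local Notation M := (good L).
Implicit Types (a b : M) (p q : M * M).

(* [good_add] is not associative in general, so the bracketing of three-fold
   sums matters: they associate to the left. For instance, in the chain
   0 < h < x < 1 that is the ordinal sum of {0, h, 1} (with h * h = 0) and an
   idempotent x, one has ((x) + (h)) + (h) = (1, 1) and
   (x) + ((h) + (h)) = (1, x). *)
Definition chang_eqv p q : Prop :=
  exists k : M, p.1 +M q.2 +M k = p.2 +M q.1 +M k.

Definition chang_class p : set (M * M) := [set q | chang_eqv p q]%classic.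

Definition chang := {X : set (M * M) | exists p, X = chang_class p}.

Definition chang_mk a b : chang :=
  exist _ (chang_class (a, b)) (ex_intro _ (a, b) erefl).

(* The operations on classes use a chosen representative of each class; that
   the choice does not matter has to be proved separately. *)
Definition chang_repr (X : chang) : M * M := projT1 (cid (proj2_sig X)).

Definition chang_add (X Y : chang) : chang :=
  chang_mk ((chang_repr X).1 +M (chang_repr Y).1)
           ((chang_repr X).2 +M (chang_repr Y).2).

Definition chang_opp (X : chang) : chang :=
  chang_mk (chang_repr X).2 (chang_repr X).1.

Definition chang_zero : chang := chang_mk good_zero good_zero.

Definition chang_le (X Y : chang) : Prop :=
  exists a b c e k : M, [/\ X = chang_mk a b, Y = chang_mk c e &
    a +M e +M k <= b +M c +M k].

End ChangGroup.
Arguments chang {d} L.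

Definition is_join (G : Type) (le : G -> G -> Prop) (x y z : G) : Prop :=
  [/\ le x z, le y z & forall t, le x t -> le y t -> le z t].

Definition is_meet (G : Type) (le : G -> G -> Prop) (x y z : G) : Prop :=
  [/\ le z x, le z y & forall t, le t x -> le t y -> le t z].

Record lattice_ordered_abelian_group (G : Type) (add : G -> G -> G)
    (opp : G -> G) (zero : G) (le : G -> G -> Prop) : Prop := {
  loag_addA : associative add;
  loag_addC : commutative add;
  loag_add0 : left_id zero add;
  loag_addN : left_inverse zero opp add;
  loag_refl : forall x, le x x;
  loag_anti : forall x y, le x y -> le y x -> x = y;
  loag_trans : forall x y z, le x y -> le y z -> le x z;
  loag_add2r : forall x y z, le x y -> le (add x z) (add y z);
  loag_join : forall x y, exists z, is_join le x y z;
  loag_meet : forall x y, exists z, is_meet le x y z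
}.

(* Main.v *)
(* Every BL-algebra is a subdirect product of chains, and in a chain each element
   is either regular (~~x = x) or dense (~x = 0). Addition of good sequences is
   associative among sequences with regular entries and among sequences with
   entries in {0} u {dense}; it fails only when the two kinds are mixed. Let [u]
   be a finite set containing all the entries of the sequences at hand. There is an
   element [absorber u], given by a lattice term in [u], that in each chain quotient
   does one of two things. If [u] has a regular member other than 0 and 1, then so
   is [absorber u], and adding the sequence ([absorber u]) identifies every [a] with
   ~~a. If not, then [absorber u] is the product of the dense members of [u], and
   every entry already lies in {0} u {dense}. In both cases the equality or
   inequality after adding ([absorber u]) can be checked in an associative monoid
   where each sequence with entries in [u] divides ([absorber u]) up to an integer.
   So "a + k <= b + k for some k" is a preorder that is compatible with addition
   and cancellative, its quotient is a cancellative lattice-ordered commutative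
   monoid, and the Chang group is the group of differences of that monoid. *)
From HB Require Import structures.
From mathcomp Require Import all_boot all_order all_algebra.
From mathcomp Require Import zify boolp classical_sets.
Require Import Defs.

Set Implicit Arguments.
Unset Strict Implicit.
Unset Printing Implicit Defensive.

Import Order.TTheory.
Local Open Scope order_scope.
Local Open Scope bl_scope.

(** * Sequences of ones followed by one further entry, and their sums *)

Section Step.
Context {d : Order.disp_t} {L : blAlgType d}.
Implicit Types (x y z : L) (a b c : good L) (p q n : nat).

(** The sequence (1, ..., 1, x, 0, ...) with [p] ones. In a chain every good sequence has this
    form. *)
Definition step p x : nat -> L :=
  fun i => if (i < p)%N then \top else if i == p then x else \bot.

Lemma seq_ext_step p x i : seq_ext (step p x) i =
  if (i <= p)%N then \top else if i == p.+1 then x else \bot.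
Proof. by case: i. Qed.

(** In the sum of [seq_addE] some term is 1 at each index below [p + q]. At [p + q] only [x * 1] and
    [1 * y] survive, at the next index only [x * y]. *)
Lemma seq_add_step p q x y i : seq_add (step p x) (step q y) i =
  if (i < p + q)%N then \top else if i == (p + q)%N then x + y
  else if i == (p + q).+1 then x * y else \bot.
Proof.
rewrite seq_addE; case: ltngtP => ipq.
(* At [j = minn q i.+1] both factors are 1. *)
- have jP : (minn q i.+1 < i.+2)%N by rewrite ltnS geq_minr.
  rewrite (bigD1 (Ordinal jP)) //= !seq_ext_step geq_minl.
  rewrite (_ : (i.+1 - _ <= p)%N) ?blmul1x ?bladd1x //.
  by rewrite leq_subLR minnE; lia.
- have zero (j : 'I_i.+2) : j != q.+1 :> nat ->
      seq_ext (step p x) (i.+1 - j)%N * seq_ext (step q y) j = \bot.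
    move=> jq; rewrite !seq_ext_step (negbTE jq).
    have [jq'|qj] := leqP j q; last by rewrite blmulx0.
    by rewrite ifF ?ifF ?blmul0x //; lia.
  case: eqP => [iE|iE].
    have jP : (q.+1 < i.+2)%N by lia.
    rewrite (bigD1 (Ordinal jP)) //= big1 => [|j jq]; last exact: zero.
    by rewrite bladdx0 !seq_ext_step /= /step ltnn eqxx ifF ?ifT //; lia.
  rewrite big1 // => j _; have [jq|/zero //] := eqVneq (j : nat) q.+1.
  by rewrite seq_ext_step jq ifF ?ifF ?blmul0x //; lia.
have j1 : (q < i.+2)%N by lia.
have j2 : (q.+1 < i.+2)%N by lia.
rewrite (bigD1 (Ordinal j1)) //= (bigD1 (Ordinal j2)) /=; last first.
  by rewrite -val_eqE /= gtn_eqF.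
rewrite big1 => [|j /andP[/eqP jq /eqP jq']].
  rewrite bladdx0 !seq_ext_step /= /step ipq.
  have [-> ->] : (p + q).+1 - q = p.+1 /\ (p + q).+1 - q.+1 = p by lia.
  by rewrite !(ltnn, eqxx, leqnn) blmulx1 blmul1x.
have {}jq : j <> q :> nat by move=> E; apply: jq; apply: val_inj.
have {}jq' : j <> q.+1 :> nat by move=> E; apply: jq'; apply: val_inj.
rewrite !seq_ext_step; have [jq2|qj] := leqP j q.
  by rewrite ifF ?ifF ?blmul0x //; lia.
by rewrite (ifF _ _ (introF eqP jq')) blmulx0.
Qed.

Lemma good_step p x : good_seq (step p x).
Proof.
split=> [i|]; last first.
  by exists p.+1 => i pi; rewrite /step ifF ?ifF //; lia.
rewrite /step; case: (ltngtP i p) => ip; rewrite ?bladd1x //.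
  by rewrite !ifF ?bladdx0 //; lia.
by rewrite !ifF ?bladdx0 //; lia.
Qed.

Definition gstep p x : good L := Good _ (good_step p x).

Lemma gstep_bot p : gstep p.+1 \bot = gstep p \top.
Proof.
apply: good_ext => i; rewrite /= /step ltnS.
by case: ltngtP => // _; case: eqP.
Qed.

Lemma gstep_addM0 p q x y : x * y = \bot ->
  gstep p x +M gstep q y = gstep (p + q) (x + y).
Proof.
move=> xy; apply: good_ext => i; rewrite /= seq_add_step /step xy.
by case: ltngtP => //; case: ifP.
Qed.

Lemma gstep_addD1 p q x y : x + y = \top ->
  gstep p x +M gstep q y = gstep (p + q).+1 (x * y).
Proof.
move=> xy; apply: good_ext => i; rewrite /= seq_add_step /step xy ltnS.
by case: ltngtP.
Qed.

Lemma gstep_le p x y : x <= y -> gstep p x <= gstep p y.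
Proof.
by move=> xy; apply/good_leP => i; rewrite /= /step; case: ltngtP.
Qed.

Lemma gstep_lt p q x y : (p < q)%N -> gstep p x <= gstep q y.
Proof.
move=> pq; apply/good_leP => i; rewrite /= /step.
case: (ltngtP i q) => iq; rewrite ?lex1 //; case: ltngtP => ip; rewrite ?le0x //; lia.
Qed.

Lemma good_add_le a b c e : a <= b -> c <= e -> a +M c <= b +M e.
Proof.
move=> /good_leP ab /good_leP ce; apply/good_leP => i; rewrite /= /seq_add.
apply: bladd_le2 => //; apply: bladd_le2 => //.
elim/big_rec2: _ => // j x y _ xy; apply: bladd_le2 => //.
exact: blmul_le2.
Qed.

Lemma good_addx0 a : a +M good_zero = a.
Proof.
apply: good_ext => i; rewrite /= /seq_add big1 ?bladdx0 // => j _.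
exact: blmulx0.
Qed.

End Step.

(** * Good sequences over a chain *)

Section RegularOrDense.
Context {d : Order.disp_t} {L : blAlgType d}.
Hypothesis tot : forall x y : L, x <= y \/ y <= x.
Implicit Types (x y z : L) (u : seq L) (a b c k m : good L) (p q r n : nat).
Local Notation neg := (@blneg d L).

Lemma gstepP a : exists p x, a = gstep p x.
Proof.
have [p [x aE]] := chain_shape tot (goodP a).
by exists p, x; apply: good_ext.
Qed.

Lemma good_total a b : a <= b \/ b <= a.
Proof.
have [p [x ->]] := gstepP a; have [q [y ->]] := gstepP b.
case: (ltngtP p q) => [pq|qp|->]; first by left; apply: gstep_lt.
  by right; apply: gstep_lt.
by case: (tot x y) => ?; [left|right]; apply: gstep_le.
Qed.

(** By [chain_add_mul] at most one of [x + y] and [x * y] differs from 0 and 1, so the sum is again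
    a single step. *)
Lemma gstep_addP p q x y :
  (x * y = \bot /\ gstep p x +M gstep q y = gstep (p + q) (x + y)) \/
  (x + y = \top /\ gstep p x +M gstep q y = gstep (p + q).+1 (x * y)).
Proof.
case: (chain_add_mul tot x y) => xy; [right|left]; split => //.
  exact: gstep_addD1.
exact: gstep_addM0.
Qed.

Lemma chain_good_addC a b : a +M b = b +M a.
Proof.
have [p [x ->]] := gstepP a; have [q [y ->]] := gstepP b.
have [[xy ->]|[xy ->]] := gstep_addP p q x y.
  by rewrite gstep_addM0 1?blmulC // addnC bladdC.
by rewrite gstep_addD1 1?bladdC // addnC blmulC.
Qed.

(** Adding the integer [gstep n \bot], which consists of [n] ones, only shifts the entries by [n]
    places. *)
Lemma good_add_stepK n a b :
  a +M gstep n \bot <= b +M gstep n \bot -> a <= b.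
Proof.
have [p [x ->]] := gstepP a; have [q [y ->]] := gstepP b.
rewrite !gstep_addM0 ?blmulx0 // !bladdx0 => /good_leP H.
apply/good_leP => i; have := H (i + n)%N.
by rewrite /= /step !ltn_add2r !eqn_add2r.
Qed.

(* Addition of good sequences fails to be associative only through the entry
   equated here: [(x) + (y) + (z)] has entries [x + y + z], [(x + y) * z + x * y]
   and [x * y * z]. *)
Definition mid_assoc x y z := (x + y) * z + x * y = x * (y + z) + y * z.

(** In each of the four cases for the pairs [x], [y] and [y], [z], the hypothesis reduces to the one
    equality that associativity of [+] and [*] does not supply. *)
Lemma gstep_addA p q r x y z : mid_assoc x y z ->
  gstep p x +M (gstep q y +M gstep r z) = gstep p x +M gstep q y +M gstep r z.
Proof.
rewrite /mid_assoc => S.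
have [[xy ->]|[xy ->]] := gstep_addP p q x y;
  have [[yz ->]|[yz ->]] := gstep_addP q r y z.
- move: S; rewrite xy yz !bladdx0 => S.
  have [[s0 ->]|[s1 ->]] := gstep_addP (p + q) r (x + y) z.
    by rewrite gstep_addM0 -?S // addnA bladdA.
  by rewrite gstep_addD1 ?bladdA // addnA S.
- move: S; rewrite xy yz bladdx0 blmulx1 => S.
  have s1 : x + y + z = \top by rewrite -bladdA yz bladdC bladd1x.
  rewrite [RHS]gstep_addD1 // S.
  by rewrite gstep_addM0 ?blmulA ?xy ?blmul0x // addnS addnA.
- move: S; rewrite xy yz bladdx0 blmul1x => S.
  have s1 : x + (y + z) = \top by rewrite bladdA xy bladd1x.
  rewrite [LHS]gstep_addD1 // -S.
  by rewrite gstep_addM0 -?blmulA ?yz ?blmulx0 // addSn addnA bladdC.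
- move: S; rewrite xy yz blmul1x blmulx1 bladdC => S.
  have [[s0 ->]|[s1 ->]] := gstep_addP (p + q).+1 r (x * y) z.
    by rewrite gstep_addM0 ?blmulA // addSn addnS addnA S.
  by rewrite gstep_addD1 -?S // blmulA addSn addnS addnA.
Qed.

Lemma mid_assocC x y z : mid_assoc x y z -> mid_assoc z y x.
Proof.
rewrite /mid_assoc => S.
by rewrite blmulC (bladdC z) (blmulC z y) -S (blmulC z) (bladdC y) (blmulC y).
Qed.

(** * Elements that are zero or dense *)

Definition bldz x := (x == \bot) || (neg x == \bot).

Lemma bldense_add x y : neg x = \bot -> neg y = \bot -> x + y = \top.
Proof.
(* [chain_addE] needs nonzero summands; a dense zero forces 0 = 1. *)
move=> x0 y0; have [xE|xN] := eqVneq x \bot.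
  by apply/eqP; rewrite -le1x -(@blneg0 _ L) -{1}xE x0 le0x.
have [yE|yN] := eqVneq y \bot.
  by apply/eqP; rewrite -le1x -(@blneg0 _ L) -{1}yE y0 le0x.
by rewrite chain_addE // x0 blmul0x blneg0.
Qed.

Lemma bldense_mul x y : neg x = \bot -> neg y = \bot -> neg (x * y) = \bot.
Proof. by move=> x0 y0; rewrite blnegM y0. Qed.

Lemma bldz_add x y : bldz x -> bldz y -> bldz (x + y).
Proof.
move=> /orP[/eqP->|/eqP x0]; first by rewrite bladd0x.
move=> /orP[/eqP->|/eqP y0]; first by rewrite bladdx0 /bldz x0 eqxx orbT.
by rewrite bldense_add // /bldz blneg1 eqxx orbT.
Qed.

Lemma bldz_mul x y : bldz x -> bldz y -> bldz (x * y).
Proof.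
move=> /orP[/eqP->|/eqP x0]; first by rewrite blmul0x /bldz eqxx.
move=> /orP[/eqP->|/eqP y0]; first by rewrite blmulx0 /bldz eqxx.
by rewrite /bldz bldense_mul // eqxx orbT.
Qed.

(** A zero among the three makes it trivial. For dense elements both sides are 1, since dense
    elements are closed under [*] and any two of them add up to 1. *)
Lemma bldz_mid_assoc x y z : bldz x -> bldz y -> bldz z -> mid_assoc x y z.
Proof.
rewrite /mid_assoc => /orP[/eqP->|/eqP x0].
  by rewrite !bladd0x !blmul0x bladdx0 bladd0x.
move=> /orP[/eqP->|/eqP y0].
  by rewrite bladdx0 bladd0x blmulx0 blmul0x !bladdx0.
move=> /orP[/eqP->|/eqP z0].
  by rewrite bladdx0 !blmulx0 bladd0x bladdx0.
rewrite (bldense_add x0 y0) (bldense_add y0 z0) blmul1x blmulx1.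
by rewrite !bldense_add ?bldense_mul.
Qed.

(** * Regular elements, with the arithmetic of an MV-chain *)

Definition blreg x := neg (neg x) == x.

Lemma blreg_neg x : blreg (neg x).
Proof. by rewrite /blreg blneg3. Qed.

Lemma blreg_bot : blreg \bot.
Proof. by rewrite /blreg blneg0 blneg1. Qed.

Lemma blreg_top : blreg \top.
Proof. by rewrite /blreg blneg1 blneg0. Qed.

Lemma blreg_addE x y : blreg x -> blreg y -> x + y = neg (neg x * neg y).
Proof.
move=> /eqP xx /eqP yy; have [->|x0] := eqVneq x \bot.
  by rewrite bladd0x blneg0 blmul1x.
have [->|y0] := eqVneq y \bot; first by rewrite bladdx0 blneg0 blmulx1.
exact: chain_addE.
Qed.

Lemma blreg_add x y : blreg x -> blreg y -> blreg (x + y).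
Proof. by move=> xx yy; rewrite blreg_addE // blreg_neg. Qed.

Lemma neg_bot_le x y : x <= y -> neg x = \bot -> neg y = \bot.
Proof. by move=> /blneg_le + x0; rewrite x0 lex0 => /eqP. Qed.

Lemma blnegneg_mul x y : neg (neg (x * y)) = neg (neg x) * neg (neg y).
Proof.
case: (chain_reg tot x) => [x0|xx].
  by rewrite blmulC blnegM x0 blneg0 blmul1x.
case: (chain_reg tot y) => [y0|yy].
  by rewrite blnegM y0 blneg0 blmulx1.
rewrite xx yy; case: (chain_reg tot (x * y)) => // xy0.
have x0 := neg_bot_le (blmul_lel x y) xy0.
have y0 := neg_bot_le (blmul_ler x y) xy0.
by rewrite xy0 -xx -yy x0 y0 blneg0 blmulx1.
Qed.

Lemma blnegneg_add x y : neg (neg (x + y)) = neg (neg x) + neg (neg y).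
Proof.
have [->|x0] := eqVneq x \bot; first by rewrite blneg0 blneg1 !bladd0x.
have [->|y0] := eqVneq y \bot; first by rewrite blneg0 blneg1 !bladdx0.
by rewrite chain_addE // [RHS]blreg_addE ?blreg_neg // !blneg3.
Qed.

Lemma blreg_mul x y : blreg x -> blreg y -> blreg (x * y).
Proof. by rewrite /blreg blnegneg_mul => /eqP-> /eqP->. Qed.

Lemma blreg_negM x y : blreg x -> blreg y -> neg (x * y) = neg x + neg y.
Proof. by move=> /eqP xx /eqP yy; rewrite blreg_addE ?blreg_neg // xx yy. Qed.

Lemma blreg_negD x y : blreg x -> blreg y -> neg (x + y) = neg x * neg y.
Proof.
by move=> xx yy; rewrite blreg_addE // (eqP (blreg_mul _ _)) ?blreg_neg.
Qed.

(** This is divisibility, as [neg y ~> x] equals [x + y]. In MV terms [x * neg y] is the truncated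
    difference of [x] and [y]. *)
Lemma blreg_addI x y : blreg x -> blreg y -> (x + y) * neg y = x `&` neg y.
Proof.
move=> xx yy; rewrite meetC bldiv blmulC; congr (_ * _).
by rewrite blreg_addE // blmulC blnegM (eqP xx).
Qed.

(** The dual of [blreg_addI]: the left side is the negation of [(neg x + y) * neg y], which is
    [neg x]. *)
Lemma blreg_subK x y : blreg x -> blreg y -> y <= x -> x * neg y + y = x.
Proof.
move=> xx yy yx.
rewrite blreg_addE ?blreg_mul ?blreg_neg // (blreg_negM xx) ?blreg_neg // (eqP yy).
rewrite blreg_addI ?blreg_neg // (meet_idPl _) ?(eqP xx) //.
exact: blneg_le.
Qed.

Lemma blmul_eq0 x y : (x * y == \bot) = (x <= neg y).
Proof. by rewrite -lex0 bladj. Qed.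

Lemma blreg_add_eq1 x y : blreg x -> blreg y -> (x + y == \top) = (neg x <= y).
Proof.
by move=> xx yy; rewrite blreg_addE // blneg_eq1 blmul_eq0 (eqP yy).
Qed.

(** From [y * z = 0] one gets [z = neg y * (y + z)], and [(x + y) * neg y = x] because
    [x <= neg y]. *)
Lemma blreg_mid_assoc00 x y z : blreg x -> blreg y -> blreg z ->
  x * y = \bot -> y * z = \bot -> (x + y) * z = x * (y + z).
Proof.
move=> xx yy zz /eqP; rewrite blmul_eq0 => xy /eqP; rewrite blmul_eq0 => yz.
have zE : z = neg y * neg (neg z * neg y).
  rewrite -blreg_negD ?blreg_mul ?blreg_neg // bladdC.
  by rewrite blreg_subK ?blreg_neg // (eqP zz).
rewrite {1}zE blmulA blreg_addI // (meet_idPl xy); congr (_ * _).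
by rewrite blreg_addE // blmulC.
Qed.

(** Since [neg z <= y], [y] is [y * z + neg z]. Multiplying by [z] removes the summand [neg z] from
    [x + y * z + neg z], because [x + y * z <= z]. *)
Lemma blreg_mid_assoc01 x y z : blreg x -> blreg y -> blreg z ->
  x * y = \bot -> y + z = \top -> (x + y) * z = x + y * z.
Proof.
move=> xx yy zz /eqP; rewrite blmul_eq0 => xy yz.
have zy : neg z <= y by rewrite -blreg_add_eq1 // bladdC yz.
have yE : y * z + neg z = y.
  by rewrite -{1}(eqP zz) blreg_subK ?blreg_neg.
rewrite -{1}yE bladdA -{3}(eqP zz) blreg_addI ?blreg_add ?blreg_mul ?blreg_neg //.
rewrite (eqP zz); apply/meet_idPl.
rewrite -[leRHS](@blreg_subK z (y * z)) ?blreg_mul ?blmul_ler //.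
apply: bladd_le2 => //; apply: le_trans xy _.
by rewrite -{1}yE blreg_negD ?blreg_mul ?blreg_neg // (eqP zz) blmulC.
Qed.

(** When both sums are 1, negation turns the claim into the case where both products are 0. The two
    mixed cases are mirror images of each other. *)
Lemma blreg_mid_assoc x y z : blreg x -> blreg y -> blreg z -> mid_assoc x y z.
Proof.
move=> xx yy zz; rewrite /mid_assoc.
case: (chain_add_mul tot x y) => xy; case: (chain_add_mul tot y z) => yz.
- rewrite xy yz blmul1x blmulx1 bladdC.
  have := @blreg_mid_assoc00 (neg x) (neg y) (neg z).
  rewrite !blreg_neg -!blreg_negD // xy yz blneg1 => /(_ isT isT isT erefl erefl) E.
  rewrite (blreg_addE (blreg_mul xx yy) zz) (blreg_addE xx (blreg_mul yy zz)).
  by rewrite (blreg_negM xx yy) (blreg_negM yy zz) E.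
- apply: mid_assocC; rewrite /mid_assoc (blmulC z) yz bladdx0 (bladdC y) xy blmulx1.
  by rewrite blreg_mid_assoc01 // 1?blmulC // bladdC.
- by rewrite xy yz bladdx0 blmulx1 blreg_mid_assoc01.
- by rewrite xy yz !bladdx0 blreg_mid_assoc00.
Qed.

(** * Restricting the entries of sequences, and absorption *)

Definition entries (X : pred L) a := `[< forall i, X (a i) >].

Lemma entries_gstep (X : pred L) p x :
  X \top -> X \bot -> entries X (gstep p x) = X x.
Proof.
move=> X1 X0; apply/asboolP/idP => [/(_ p)|Xx i]; rewrite /= /step ?ltnn ?eqxx //.
by case: ltngtP.
Qed.

Lemma entries_add (X : pred L) a b : X \top -> X \bot ->
  (forall x y, X x -> X y -> X (x + y)) -> (forall x y, X x -> X y -> X (x * y)) ->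
  entries X a -> entries X b -> entries X (a +M b).
Proof.
move=> X1 X0 XD XM.
have [p [x ->]] := gstepP a; have [q [y ->]] := gstepP b.
rewrite !entries_gstep // => Xx Xy.
by have [[_ ->]|[_ ->]] := gstep_addP p q x y; rewrite entries_gstep //; auto.
Qed.

Lemma entries_addA (X : pred L) a b c : X \top -> X \bot ->
  (forall x y z, X x -> X y -> X z -> mid_assoc x y z) ->
  entries X a -> entries X b -> entries X c -> a +M (b +M c) = a +M b +M c.
Proof.
move=> X1 X0 XA; have [p [x ->]] := gstepP a; have [q [y ->]] := gstepP b.
have [r [z ->]] := gstepP c.
by rewrite !entries_gstep // => Xx Xy Xz; apply/gstep_addA/XA.
Qed.

(* On the summands satisfying [P], adding [m] forgets everything but the image
   under [psi], which lands in a submonoid [T] where addition is associative.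
   When [k] is absorbed, [psi k] is a summand of [m] up to an integer
   [gstep n \bot]; this is why [k] can be cancelled after adding [m]. *)
Record absorbing (P T : pred (good L)) (psi : good L -> good L) m : Prop := {
  abs_T : forall a, P a -> T (psi a);
  abs_addP : forall a b, P a -> P b -> P (a +M b);
  abs_addT : forall a b, T a -> T b -> T (a +M b);
  abs_addA : forall a b c, T a -> T b -> T c -> a +M (b +M c) = a +M b +M c;
  abs_int : forall n, T (gstep n \bot);
  abs_m : T m;
  abs_psiD : forall a b, P a -> P b -> psi (a +M b) = psi a +M psi b;
  abs_psi_le : forall a b, a <= b -> psi a <= psi b;
  abs_addm : forall a, P a -> a +M m = psi a +M m
}.

Section Absorbing.
Variables (P T : pred (good L)) (psi : good L -> good L) (m : good L).
Hypothesis abs : absorbing P T psi m.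

Definition absorbed k :=
  P k /\ exists t n, T t /\ psi k +M t = m +M gstep n \bot.

(** Apply [psi] to the inequality and work in [T]: adding [t] completes [psi (c +M k)] to [m] plus
    an integer, and the integer cancels. *)
Lemma absorb_cancel a b c k : P a -> P b -> P c -> P k -> absorbed (c +M k) ->
  a +M c +M k <= b +M c +M k -> a +M m <= b +M m.
Proof.
case: abs => psiT PD TD TA Tint Tm psiD psi_le addm.
move=> Pa Pb Pc Pk [_ [t [n [Tt]]]]; rewrite psiD // => tE /psi_le.
rewrite !psiD ?PD // -!TA ?psiT // => H; rewrite [leLHS]addm // [leRHS]addm //.
apply: (@good_add_stepK n); rewrite -!TA ?psiT // -tE !TA ?psiT ?TD ?psiT //.
by apply: good_add_le => //; rewrite -!TA ?psiT.
Qed.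

Lemma absorb_add2r a b c : P a -> P b -> P c ->
  a +M m <= b +M m -> a +M c +M m <= b +M c +M m.
Proof.
case: abs => psiT PD TD TA Tint Tm psiD psi_le addm Pa Pb Pc.
rewrite [leLHS]addm // [leRHS]addm // => H.
rewrite ![_ +M c +M m]addm ?PD // !psiD // -!TA ?psiT //.
by rewrite !(chain_good_addC (psi c)) !TA ?psiT //; apply: good_add_le.
Qed.

Lemma absorb_addA a b c : P a -> P b -> P c ->
  a +M (b +M c) +M m = a +M b +M c +M m.
Proof.
case: abs => psiT PD TD TA Tint Tm psiD psi_le addm Pa Pb Pc.
by rewrite [LHS]addm ?PD // [RHS]addm ?PD // !psiD ?PD // TA ?psiT.
Qed.

End Absorbing.

(** * Absorption by a regular element other than 0 and 1, and by a dense element *)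

Lemma negneg_good a : good_seq (fun i => neg (neg (a i))).
Proof.
have [ga [r ar]] := goodP a; split=> [i|]; first by rewrite -blnegneg_add ga.
by exists r => i /ar ->; rewrite blneg0 blneg1.
Qed.

Definition negneg a : good L := Good _ (negneg_good a).

Lemma negneg_gstep p x : negneg (gstep p x) = gstep p (neg (neg x)).
Proof.
apply: good_ext => i; rewrite /= /step.
by case: ltngtP; rewrite ?blneg1 ?blneg0 ?blneg1.
Qed.

Lemma negneg_add a b : negneg (a +M b) = negneg a +M negneg b.
Proof.
have [p [x ->]] := gstepP a; have [q [y ->]] := gstepP b.
rewrite !negneg_gstep; have [[xy ->]|[xy ->]] := gstep_addP p q x y;
  rewrite negneg_gstep.
  by rewrite gstep_addM0 ?blnegneg_add // -blnegneg_mul xy blneg0 blneg1.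
by rewrite gstep_addD1 ?blnegneg_mul // -blnegneg_add xy blneg1 blneg0.
Qed.

(** Density of [x] gives [x ~> z = z], and [z <= x] since otherwise [z] would be dense; divisibility
    concludes. *)
Lemma bldense_mulr x z : neg x = \bot -> blreg z -> neg z != \bot -> x * z = z.
Proof.
move=> x0 /eqP zz nz; have xzE : x ~> z = z.
  by rewrite -{1}zz -blnegM blmulC blnegM x0.
have zx : z <= x.
  by case: (tot z x) => // /neg_bot_le /(_ x0) /eqP; rewrite (negbTE nz).
by rewrite -{1}xzE -bldiv; apply/meet_idPr.
Qed.

(** Only a dense last entry [x] changes under double negation, to 1. As [x + z = 1] and [x * z = z],
    the sum with [z] does not see the change. *)
Lemma add_proper_regular a z : z != \bot -> neg z != \bot ->
  a +M gstep 0 z = negneg a +M gstep 0 z.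
Proof.
move=> z0 nz; have zz : blreg z.
  by case: (chain_reg tot z) => /eqP // E; rewrite E in nz.
have [p [x ->]] := gstepP a; rewrite negneg_gstep.
case: (chain_reg tot x) => [x0|-> //].
have [xE|xN] := eqVneq x \bot.
  by move: x0 nz; rewrite xE blneg0 => E; rewrite -lex0 -E lex1.
rewrite gstep_addD1; last by rewrite chain_addE // x0 blmul0x blneg0.
by rewrite x0 blneg0 gstep_addD1 ?bladd1x // blmul1x bldense_mulr.
Qed.

Lemma regular_absorbing z : z != \bot -> neg z != \bot ->
  absorbing predT (entries blreg) negneg (gstep 0 z).
Proof.
move=> z0 nz; have [r1 r0] := (blreg_top, blreg_bot).
split=> // [a _|a b|a b c|n||a b _ _|a b /good_leP ab|a _].
- by apply/asboolP => i; apply: blreg_neg.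
- by apply: entries_add => //; [apply: blreg_add|apply: blreg_mul].
- by apply: entries_addA => //; apply: blreg_mid_assoc.
- by rewrite entries_gstep.
- rewrite entries_gstep => //.
  by case: (chain_reg tot z) => /eqP // E; rewrite E in nz.
- exact: negneg_add.
- by apply/good_leP => i; do 2 apply: blneg_le.
- exact: add_proper_regular.
Qed.

(* The complement of [k] is [1 - k] up to an integer. *)
Lemma regular_absorbed z k : z != \bot -> neg z != \bot ->
  absorbed predT (entries blreg) negneg (gstep 0 z) k.
Proof.
move=> z0 nz; have abs := regular_absorbing z0 nz; split=> //.
have [p [x ->]] := gstepP k; exists (gstep 0 (neg x) +M gstep 0 z), p.+1.
have Tx : entries blreg (gstep 0 (neg x)).
  by rewrite entries_gstep ?blreg_neg ?blreg_top ?blreg_bot.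
split; first by apply: (abs_addT abs) => //; apply: abs_m abs.
rewrite (abs_addA abs) ?(abs_m abs) ?(abs_T abs) // negneg_gstep chain_good_addC.
congr (_ +M _); rewrite gstep_addM0 1?blmulC ?blmul_neg // addn0 gstep_bot.
by rewrite blreg_addE ?blreg_neg // blneg3 blmul_neg blneg0.
Qed.

(** Addition is already associative among these sequences, so [psi] can be the identity. *)
Lemma dense_absorbing z : neg z = \bot ->
  absorbing (entries bldz) (entries bldz) id (gstep 0 z).
Proof.
move=> z0; have [r1 r0] : bldz \top /\ bldz \bot.
  by rewrite /bldz blneg1 eqxx orbT.
have D : forall a b, entries bldz a -> entries bldz b -> entries bldz (a +M b).
  by move=> a b; apply: entries_add => //; [apply: bldz_add|apply: bldz_mul].
split=> // [a b c|n|].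
- by apply: entries_addA => //; apply: bldz_mid_assoc.
- by rewrite entries_gstep.
- by rewrite entries_gstep => //; rewrite /bldz z0 eqxx orbT.
Qed.

(** * One absorbing element for a finite set of entries *)

(** The factor contributed by [x] is 1 if [x] is zero and [x] itself if [x] is dense. *)
Definition core (u : seq L) := foldr (fun x y => (x `|` neg x) * y) \top u.
(** In a chain the contribution of [x] is 0 exactly when [x] is zero or dense. *)
Definition skew (u : seq L) := foldr (fun x y => (x `&` neg x) `|` y) \bot u.

(* In a chain, [skew u] is a regular element other than 0 and 1 as soon as
   [u] contains one, and then so is [absorber u]; otherwise [skew u = \bot] and
   [absorber u] is the product of the dense members of [u]. *)
Definition absorber (u : seq L) := (core u `&` neg (skew u)) `|` skew u.

(** In a chain the join is 0 or attained at one [x], and the meet of [x] and [neg x] has square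
    0. *)
Lemma skew_le_neg u : skew u <= neg (skew u).
Proof.
have E : skew u = \bot \/ exists x, skew u = x `&` neg x.
  elim: u => [|x u IH] /=; first by left.
  case: (tot (x `&` neg x) (skew u)) => [/join_idPr ->|/join_idPl ->] //.
  by right; exists x.
case: E => [->|[x ->]]; first exact: le0x.
by rewrite -bladj -(blmul_neg x) blmul_le2 ?leIl ?leIr.
Qed.

Lemma skew_bot u x : skew u = \bot -> x \in u -> bldz x.
Proof.
move=> /eqP; elim: u => //= y u IH; rewrite -lex0 leUx !lex0 => /andP[y0 u0].
rewrite in_cons => /orP[/eqP->|/(IH u0) //].
by rewrite /bldz; case: (chain_meet tot y (neg y)) y0 => -> ->; rewrite ?orbT.
Qed.

Lemma core_dense u : all bldz u -> neg (core u) = \bot.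
Proof.
elim: u => [|x u IH] /=; first by rewrite blneg1.
move=> /andP[/orP[/eqP->|/eqP x0] /IH u0].
  by rewrite blneg0 joinx1 blmul1x.
by rewrite x0 joinx0 bldense_mul.
Qed.

(** The cofactor is the product of the remaining factors, all of them dense. *)
Lemma core_div u x : all bldz u -> x \in u -> neg x = \bot ->
  exists2 t, neg t = \bot & core u = x * t.
Proof.
move=> + + x0; elim: u => //= y u IH /andP[yd ud].
rewrite in_cons => /orP[/eqP E|xu].
  by exists (core u); rewrite ?core_dense // -E x0 joinx0.
have [t t0 ->] := IH ud xu.
exists ((y `|` neg y) * t); last by rewrite !blmulA (blmulC x).
apply: bldense_mul => //; case/orP: yd => /eqP y0; rewrite y0 ?joinx0 //.
by rewrite blneg0 joinx1 blneg1.
Qed.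

Definition supp_in (u : seq L) a := forall i, a i = \bot \/ a i \in u.

Lemma absorberP u : exists P T psi, absorbing P T psi (gstep 0 (absorber u)) /\
  forall a, supp_in u a -> absorbed P T psi (gstep 0 (absorber u)) a.
Proof.
have [h0|h0] := eqVneq (skew u) \bot; last first.
  (* [absorber u] lies between [skew u] and [neg (skew u)], so it is neither zero nor dense. *)
  have z0 : absorber u != \bot.
    by apply: contra_neq h0 => E; apply/eqP; rewrite -lex0 -E leUr.
  have nz : neg (absorber u) != \bot.
    apply: contra_neq h0 => E; apply/eqP; rewrite -lex0 -E.
    apply: le_trans (blle_neg2 _) _; apply: blneg_le.
    by rewrite leUx leIr skew_le_neg.
  exists predT, (entries blreg), negneg.
  split=> [|a _]; [exact: regular_absorbing|exact: regular_absorbed].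
have ud : all bldz u by apply/allP => x; apply: skew_bot.
have -> : absorber u = core u by rewrite /absorber h0 blneg0 meetx1 joinx0.
have c0 := core_dense ud.
exists (entries bldz), (entries bldz), id; split=> [|a sa].
  exact: dense_absorbing.
have ad : entries bldz a.
  by apply/asboolP => i; case: (sa i) => [->|/(allP ud) //]; rewrite /bldz eqxx.
have cd t : neg t = \bot -> entries bldz (gstep 0 t).
  by move=> t0; rewrite entries_gstep /bldz ?t0 ?blneg1 eqxx ?orbT.
split=> //; have [p [x aE]] := gstepP a.
have xE : x = a p by rewrite aE /= /step ltnn eqxx.
have [x0|xN] := eqVneq x \bot.
  exists (gstep 0 (core u)), p; split; first exact: cd.
  by rewrite aE x0 chain_good_addC.
have xu : x \in u by case: (sa p) => [|]; rewrite -xE // => /eqP; rewrite (negbTE xN).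
have x0 : neg x = \bot.
  by have /orP[/eqP E|/eqP //] := allP ud _ xu; rewrite E eqxx in xN.
have [t t0 tE] := core_div ud xu x0.
(* By density [x + t = 1], so adding [t] to [a] gives [p.+1] ones followed by [x * t = core u]. *)
exists (gstep 0 t), p.+1; split; first exact: cd.
rewrite aE gstep_addD1 ?bldense_add // -tE gstep_addM0 ?blmulx0 //.
by rewrite addn0 add0n bladdx0.
Qed.

Lemma chain_good_join_add a b c : (a `|` b) +M c = (a +M c) `|` (b +M c).
Proof.
case: (good_total a b) => ab; have abc := good_add_le ab (lexx c).
  by rewrite (join_idPr ab) (join_idPr abc).
by rewrite (join_idPl ab) (join_idPl abc).
Qed.

Lemma chain_good_meet_add a b c : (a `&` b) +M c = (a +M c) `&` (b +M c).
Proof.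
case: (good_total a b) => ab; have abc := good_add_le ab (lexx c).
  by rewrite (meet_idPl ab) (meet_idPl abc).
by rewrite (meet_idPr ab) (meet_idPr abc).
Qed.

End RegularOrDense.

(** * From chain quotients to an arbitrary BL-algebra *)

Section Transfer.
Context {d : Order.disp_t} {L : blAlgType d}.
Implicit Types (x y z : L) (u : seq L) (a b c k : good L) (s : seq (good L)).

Lemma bl_le_ext x y :
  (forall F (Fp : bl_prime F), bl_pi Fp x <= bl_pi Fp y) -> x <= y.
Proof.
move=> H; apply/meet_idPl; apply: bl_ext => F Fp.
by rewrite bl_pi_meet; apply/meet_idPl/H.
Qed.

Definition good_pi F (Fp : bl_prime F) a : good (bl_quot Fp) :=
  Good _ (bl_pi_good Fp (goodP a)).

Lemma good_pi_add F (Fp : bl_prime F) a b :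
  good_pi Fp (a +M b) = good_pi Fp a +M good_pi Fp b.
Proof. by apply: good_ext => i; apply: bl_pi_seq_add. Qed.

Lemma good_pi_join F (Fp : bl_prime F) a b :
  good_pi Fp (a `|` b) = good_pi Fp a `|` good_pi Fp b.
Proof. by apply: good_ext => i; apply: bl_pi_join. Qed.

Lemma good_pi_meet F (Fp : bl_prime F) a b :
  good_pi Fp (a `&` b) = good_pi Fp a `&` good_pi Fp b.
Proof. by apply: good_ext => i; apply: bl_pi_meet. Qed.

Lemma good_pi_gstep F (Fp : bl_prime F) p x :
  good_pi Fp (gstep p x) = gstep p (bl_pi Fp x).
Proof. by apply: good_ext => i; rewrite /= /step; case: ltngtP. Qed.

Lemma good_pi_le F (Fp : bl_prime F) a b : a <= b -> good_pi Fp a <= good_pi Fp b.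
Proof. by move=> /good_leP ab; apply/good_leP => i; apply: bl_pi_mono. Qed.

Lemma good_le_ext a b :
  (forall F (Fp : bl_prime F), good_pi Fp a <= good_pi Fp b) -> a <= b.
Proof.
move=> H; apply/good_leP => i; apply: bl_le_ext => F Fp.
by have /good_leP/(_ i) := H F Fp.
Qed.

Lemma good_eq_ext a b :
  (forall F (Fp : bl_prime F), good_pi Fp a = good_pi Fp b) -> a = b.
Proof.
by move=> H; apply/le_anti/andP; split; apply: good_le_ext => F Fp; rewrite H.
Qed.

Lemma good_addC a b : a +M b = b +M a.
Proof.
apply: good_eq_ext => F Fp; rewrite !good_pi_add.
exact: chain_good_addC (@quot_tot _ _ _ Fp) _ _.
Qed.

Lemma good_join_add a b c : (a `|` b) +M c = (a +M c) `|` (b +M c).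
Proof.
apply: good_eq_ext => F Fp; rewrite !(good_pi_add, good_pi_join).
exact: chain_good_join_add (@quot_tot _ _ _ Fp) _ _ _.
Qed.

Lemma good_meet_add a b c : (a `&` b) +M c = (a +M c) `&` (b +M c).
Proof.
apply: good_eq_ext => F Fp; rewrite !(good_pi_add, good_pi_meet).
exact: chain_good_meet_add (@quot_tot _ _ _ Fp) _ _ _.
Qed.

Lemma bl_pi_neg F (Fp : bl_prime F) x : bl_pi Fp (blneg x) = blneg (bl_pi Fp x).
Proof. by rewrite /blneg -quot_impE. Qed.

Lemma bl_pi_mul F (Fp : bl_prime F) x y :
  bl_pi Fp (x * y) = bl_pi Fp x * bl_pi Fp y.
Proof. by rewrite -quot_mulE. Qed.

(** [absorber] is a term in the BL operations, so one element serves all chain quotients at once,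
    whichever of the two cases each falls in. *)
Lemma bl_pi_absorber F (Fp : bl_prime F) u :
  bl_pi Fp (absorber u) = absorber (map (bl_pi Fp) u).
Proof.
have skewE : bl_pi Fp (skew u) = skew (map (bl_pi Fp) u).
  elim: u => //= x u <-.
  by rewrite bl_pi_join bl_pi_meet bl_pi_neg.
have coreE : bl_pi Fp (core u) = core (map (bl_pi Fp) u).
  elim: u {skewE} => //= x u <-.
  by rewrite bl_pi_mul bl_pi_join bl_pi_neg.
by rewrite bl_pi_join bl_pi_meet bl_pi_neg skewE coreE.
Qed.

Lemma supp_in_pi F (Fp : bl_prime F) u a :
  supp_in u a -> supp_in (map (bl_pi Fp) u) (good_pi Fp a).
Proof.
by move=> sa i; case: (sa i) => /= [->|au]; [left|right; apply: map_f].
Qed.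

Lemma supp_exists s : exists u, forall a, a \in s -> supp_in u a.
Proof.
elim: s => [|a s [u us]]; first by exists [::].
have [_ [r ar]] := goodP a.
exists ([seq a i | i <- iota 0 r] ++ u) => b.
rewrite in_cons => /orP[/eqP-> i|/us bu i].
  have [ri|ir] := leqP r i; first by left; apply: ar.
  by right; rewrite mem_cat map_f // mem_iota.
by case: (bu i) => [|bi]; [left|right; rewrite mem_cat bi orbT].
Qed.

Definition good_absorber u : good L := gstep 0 (absorber u).
Local Notation m := good_absorber.

(** [u] must cover [c +M k] too, because this whole sum has to divide the absorber up to an integer
    in each chain quotient. *)
Lemma absorber_cancel u a b c k :
  supp_in u a -> supp_in u b -> supp_in u c -> supp_in u k ->
  supp_in u (c +M k) ->
  a +M c +M k <= b +M c +M k -> a +M m u <= b +M m u.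
Proof.
move=> sa sb sc sk sck abck; apply: good_le_ext => F Fp.
have [P [T [psi [abs P_abs]]]] :=
  absorberP (@quot_tot _ _ _ Fp) (map (bl_pi Fp) u).
rewrite !good_pi_add good_pi_gstep bl_pi_absorber.
apply: (absorb_cancel (@quot_tot _ _ _ Fp) abs
  (c := good_pi Fp c) (k := good_pi Fp k)).
- by have [] := P_abs _ (supp_in_pi Fp sa).
- by have [] := P_abs _ (supp_in_pi Fp sb).
- by have [] := P_abs _ (supp_in_pi Fp sc).
- by have [] := P_abs _ (supp_in_pi Fp sk).
- by rewrite -good_pi_add; apply/P_abs/supp_in_pi.
- by rewrite -!good_pi_add; apply: good_pi_le.
Qed.

Lemma absorber_add2r u a b c :
  supp_in u a -> supp_in u b -> supp_in u c ->
  a +M m u <= b +M m u -> a +M c +M m u <= b +M c +M m u.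
Proof.
move=> sa sb sc ab; apply: good_le_ext => F Fp.
have [P [T [psi [abs P_abs]]]] :=
  absorberP (@quot_tot _ _ _ Fp) (map (bl_pi Fp) u).
rewrite !good_pi_add good_pi_gstep bl_pi_absorber.
apply: (absorb_add2r (@quot_tot _ _ _ Fp) abs).
- by have [] := P_abs _ (supp_in_pi Fp sa).
- by have [] := P_abs _ (supp_in_pi Fp sb).
- by have [] := P_abs _ (supp_in_pi Fp sc).
- by rewrite -bl_pi_absorber -good_pi_gstep -!good_pi_add; apply: good_pi_le.
Qed.

Lemma absorber_addA u a b c :
  supp_in u a -> supp_in u b -> supp_in u c ->
  a +M (b +M c) +M m u = a +M b +M c +M m u.
Proof.
move=> sa sb sc; apply: good_eq_ext => F Fp.
have [P [T [psi [abs P_abs]]]] :=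
  absorberP (@quot_tot _ _ _ Fp) (map (bl_pi Fp) u).
rewrite !good_pi_add good_pi_gstep bl_pi_absorber.
apply: (absorb_addA abs).
- by have [] := P_abs _ (supp_in_pi Fp sa).
- by have [] := P_abs _ (supp_in_pi Fp sb).
- by have [] := P_abs _ (supp_in_pi Fp sc).
Qed.

(** * The preorder of inequalities up to a common summand *)

Definition stable_le a b := exists k, a +M k <= b +M k.

Lemma le_stable a b : a <= b -> stable_le a b.
Proof. by move=> ab; exists good_zero; rewrite !good_addx0. Qed.

Lemma good_add0x a : good_zero +M a = a.
Proof. by rewrite good_addC good_addx0. Qed.

(** Replaces the witness [k] by one that depends on [u] alone, so that inequalities with different
    witnesses can be combined. *)
Lemma absorber_of_stable u a b k : supp_in u a -> supp_in u b -> supp_in u k ->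
  a +M k <= b +M k -> a +M m u <= b +M m u.
Proof.
move=> sa sb sk abk; apply: (@absorber_cancel u a b good_zero k) => //.
- by move=> i; left.
- by rewrite good_add0x.
- by rewrite !good_addx0.
Qed.

Lemma stable_le_trans a b c : stable_le a b -> stable_le b c -> stable_le a c.
Proof.
move=> [k abk] [l bcl]; have [u us] := supp_exists [:: a; b; c; k; l].
exists (m u); apply: (@le_trans _ _ (b +M m u)).
  by apply: (absorber_of_stable _ _ _ abk); apply: us; rewrite !in_cons eqxx ?orbT.
by apply: (absorber_of_stable _ _ _ bcl); apply: us; rewrite !in_cons eqxx ?orbT.
Qed.

Lemma stable_le_anti a b : stable_le a b -> stable_le b a ->
  exists k, a +M k = b +M k.
Proof.
move=> [k abk] [l bal]; have [u us] := supp_exists [:: a; b; k; l].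
exists (m u); apply/le_anti/andP; split.
  by apply: (absorber_of_stable _ _ _ abk); apply: us; rewrite !in_cons eqxx ?orbT.
by apply: (absorber_of_stable _ _ _ bal); apply: us; rewrite !in_cons eqxx ?orbT.
Qed.

Lemma stable_le_add2r a b c : stable_le a b -> stable_le (a +M c) (b +M c).
Proof.
move=> [k abk]; have [u us] := supp_exists [:: a; b; c; k].
exists (m u); apply: absorber_add2r;
  last (apply: (absorber_of_stable _ _ _ abk));
  by apply: us; rewrite !in_cons eqxx ?orbT.
Qed.

(** Without associativity [c +M k] need not be a witness for [a] and [b], but the absorber is
    one. *)
Lemma stable_le_cancel a b c : stable_le (a +M c) (b +M c) -> stable_le a b.
Proof.
move=> [k abk]; have [u us] := supp_exists [:: a; b; c; k; c +M k].
by exists (m u); apply: (absorber_cancel _ _ _ _ _ abk); apply: us;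
  rewrite !in_cons eqxx ?orbT.
Qed.

Lemma stable_addA a b c : exists k, a +M (b +M c) +M k = a +M b +M c +M k.
Proof.
have [u us] := supp_exists [:: a; b; c].
by exists (m u); apply: absorber_addA; apply: us; rewrite !in_cons eqxx ?orbT.
Qed.

Lemma stable_le_join a b c : stable_le a c -> stable_le b c ->
  stable_le (a `|` b) c.
Proof.
move=> [k ack] [l bcl]; have [u us] := supp_exists [:: a; b; c; k; l].
exists (m u); rewrite good_join_add leUx; apply/andP; split.
  by apply: (absorber_of_stable _ _ _ ack); apply: us; rewrite !in_cons eqxx ?orbT.
by apply: (absorber_of_stable _ _ _ bcl); apply: us; rewrite !in_cons eqxx ?orbT.
Qed.

Lemma stable_le_meet a b c : stable_le c a -> stable_le c b ->
  stable_le c (a `&` b).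
Proof.
move=> [k ack] [l bcl]; have [u us] := supp_exists [:: a; b; c; k; l].
exists (m u); rewrite good_meet_add lexI; apply/andP; split.
  by apply: (absorber_of_stable _ _ _ ack); apply: us; rewrite !in_cons eqxx ?orbT.
by apply: (absorber_of_stable _ _ _ bcl); apply: us; rewrite !in_cons eqxx ?orbT.
Qed.

(** * The quotient, a cancellative ordered commutative monoid *)

Definition stable_eq a b := `[< stable_le a b /\ stable_le b a >].

Lemma stable_eq_equiv : equiv_class_of stable_eq.
Proof.
split=> [a|a b|b a c]; first by apply/asboolP; split; apply: le_stable.
  by apply/asboolP/asboolP => -[].
by move=> /asboolP[ab ba] /asboolP[bc cb]; apply/asboolP; split;
  [apply: stable_le_trans bc|apply: stable_le_trans ba].
Qed.

Canonical stable_eq_rel := EquivRelPack stable_eq_equiv.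

Definition stable := {eq_quot stable_eq_rel}%qT.
HB.instance Definition _ := Choice.on stable.
HB.instance Definition _ := EqQuotient.on stable.

Definition cl a : stable := (\pi a)%qT.
Implicit Types X Y Z : stable.

Lemma clP a b : cl a = cl b <-> stable_le a b /\ stable_le b a.
Proof. by split=> [/eqquotP/asboolP|?] //; apply/eqquotP/asboolP. Qed.

Lemma cl_repr X : cl (repr X) = X.
Proof. exact: reprK. Qed.

Lemma stable_eq_add2r a b c : cl a = cl b -> cl (a +M c) = cl (b +M c).
Proof. by move=> /clP[ab ba]; apply/clP; split; apply: stable_le_add2r. Qed.

Definition stable_add X Y : stable := cl (repr X +M repr Y).
Definition stable_zero : stable := cl good_zero.

Fact clD_subproof a b : stable_add (cl a) (cl b) = cl (a +M b).
Proof.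
rewrite /stable_add (stable_eq_add2r _ (cl_repr _)) good_addC.
by rewrite (stable_eq_add2r _ (cl_repr _)) good_addC.
Qed.

Fact stable_addrA : associative stable_add.
Proof.
move=> X Y Z; rewrite -(cl_repr X) -(cl_repr Y) -(cl_repr Z) !clD_subproof.
have [k E] := stable_addA (repr X) (repr Y) (repr Z).
by apply/clP; split; exists k; rewrite E.
Qed.

Fact stable_addrC : commutative stable_add.
Proof. by move=> X Y; rewrite /stable_add good_addC. Qed.

Fact stable_add0r : left_id stable_zero stable_add.
Proof. by move=> X; rewrite -(cl_repr X) clD_subproof good_add0x. Qed.

HB.instance Definition _ :=
  GRing.isNmodule.Build stable stable_addrA stable_addrC stable_add0r.

Lemma clD a b : cl (a +M b) = (cl a + cl b)%R.
Proof. by rewrite -clD_subproof. Qed.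

Definition sle X Y := stable_le (repr X) (repr Y).

Lemma sle_cl a b : sle (cl a) (cl b) <-> stable_le a b.
Proof.
have /clP[a1 a2] := cl_repr (cl a); have /clP[b1 b2] := cl_repr (cl b).
split=> ab.
  exact: stable_le_trans (stable_le_trans a2 ab) b1.
exact: stable_le_trans (stable_le_trans a1 ab) b2.
Qed.

Lemma sle_refl X : sle X X.
Proof. exact: le_stable. Qed.

Lemma sle_trans X Y Z : sle X Y -> sle Y Z -> sle X Z.
Proof. exact: stable_le_trans. Qed.

Lemma sle_anti X Y : sle X Y -> sle Y X -> X = Y.
Proof. by move=> XY YX; rewrite -(cl_repr X) -(cl_repr Y); apply/clP. Qed.

Lemma sle_add2r X Y Z : sle (X + Z)%R (Y + Z)%R <-> sle X Y.
Proof.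
rewrite -(cl_repr X) -(cl_repr Y) -(cl_repr Z) -!clD !sle_cl.
by split; [apply: stable_le_cancel|apply: stable_le_add2r].
Qed.

Lemma sle_add2l X Y Z : sle (Z + X)%R (Z + Y)%R <-> sle X Y.
Proof. by rewrite !(GRing.addrC Z) sle_add2r. Qed.

(** * The Chang group as the group of differences of that monoid *)

Implicit Types p q r : good L * good L.

Definition ple p q := sle (cl p.1 + cl q.2)%R (cl p.2 + cl q.1)%R.

Lemma ple_refl p : ple p p.
Proof. by rewrite /ple GRing.addrC; apply: sle_refl. Qed.

(** X + Y' + Z' <= X' + Y + Z' <= X' + Y' + Z, and [Y'] cancels. *)
Lemma sle_diff_trans X X' Y Y' Z Z' :
  sle (X + Y')%R (X' + Y)%R -> sle (Y + Z')%R (Y' + Z)%R ->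
  sle (X + Z')%R (X' + Z)%R.
Proof.
rewrite -(sle_add2r _ _ Z') -(sle_add2l (Y + Z')%R _ X') => XY YZ.
rewrite -(sle_add2r _ _ Y') GRing.addrAC; apply: sle_trans XY _.
by rewrite -GRing.addrA -GRing.addrA (GRing.addrC Z).
Qed.

Lemma ple_trans p q r : ple p q -> ple q r -> ple p r.
Proof. exact: sle_diff_trans. Qed.

(** For the converse, [stable_le_anti] merges the two witnesses into a single [k] giving
    equality. *)
Lemma ple_eqv p q : chang_eqv p q <-> ple p q /\ ple q p.
Proof.
rewrite /ple (GRing.addrC (cl q.1)) (GRing.addrC (cl q.2)) -!clD !sle_cl.
split=> [[k E]|[pq qp]]; first by split; exists k; rewrite E.
exact: stable_le_anti.
Qed.

Lemma chang_eqvP p q :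
  chang_eqv p q <-> (cl p.1 + cl q.2 = cl p.2 + cl q.1)%R.
Proof.
rewrite ple_eqv /ple (GRing.addrC (cl q.1)) (GRing.addrC (cl q.2)).
by split=> [[]|->]; [apply: sle_anti|split; apply: sle_refl].
Qed.

Lemma chang_eqv_refl p : chang_eqv p p.
Proof. by apply/ple_eqv; split; apply: ple_refl. Qed.

Lemma chang_eqv_sym p q : chang_eqv p q -> chang_eqv q p.
Proof. by rewrite !ple_eqv => -[]. Qed.

Lemma chang_eqv_trans p q r : chang_eqv p q -> chang_eqv q r -> chang_eqv p r.
Proof.
rewrite !ple_eqv => -[pq qp] [qr rq].
by split; [apply: ple_trans qr|apply: ple_trans qp].
Qed.

Lemma chang_mk_eq p q : chang_mk p.1 p.2 = chang_mk q.1 q.2 <-> chang_eqv p q.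
Proof.
case: p q => [a b] [c e] /=; split=> [/(congr1 (@proj1_sig _ _)) /= E|E].
  have : chang_class (c, e) (c, e) by apply: chang_eqv_refl.
  by rewrite -E.
apply: eq_exist; apply/seteqP; split=> r.
  exact/chang_eqv_trans/chang_eqv_sym.
exact: chang_eqv_trans.
Qed.

Lemma chang_mk_cl a b c e :
  chang_mk a b = chang_mk c e <-> (cl a + cl e = cl b + cl c)%R.
Proof. by rewrite (chang_mk_eq (_, _) (_, _)) chang_eqvP. Qed.

Lemma chang_reprK (v : chang L) :
  chang_mk (chang_repr v).1 (chang_repr v).2 = v.
Proof.
case: v => A Ap; apply: eq_exist; rewrite /chang_repr /=.
by case: cid => -[a b] /= ->.
Qed.

Lemma chang_ind (Q : chang L -> Prop) :
  (forall a b, Q (chang_mk a b)) -> forall v, Q v.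
Proof. by move=> H v; rewrite -(chang_reprK v). Qed.

Lemma chang_repr_mk a b : chang_eqv (chang_repr (chang_mk a b)) (a, b).
Proof. exact/chang_mk_eq/chang_reprK. Qed.

Lemma chang_addE a b c e :
  chang_add (chang_mk a b) (chang_mk c e) = chang_mk (a +M c) (b +M e).
Proof.
have /chang_eqvP /= ab := chang_repr_mk a b.
have /chang_eqvP /= ce := chang_repr_mk c e.
rewrite /chang_add; set p := chang_repr _ in ab *; set q := chang_repr _ in ce *.
apply/(chang_mk_eq (_, _) (_, _))/chang_eqvP => /=.
by rewrite !clD GRing.addrACA ab ce GRing.addrACA.
Qed.

Lemma chang_oppE a b : chang_opp (chang_mk a b) = chang_mk b a.
Proof.
have /chang_eqvP /= ab := chang_repr_mk a b.
by apply/(chang_mk_eq (_, _) (_, _))/chang_eqvP.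
Qed.

(** [chang_le] asks only for some representatives; transitivity of [ple] carries the inequality to
    the given ones. *)
Lemma chang_leE a b c e :
  chang_le (chang_mk a b) (chang_mk c e) <-> ple (a, b) (c, e).
Proof.
rewrite /ple -!clD sle_cl; split=> [|[k H]]; last by exists a, b, c, e, k.
move=> [a' [b' [c' [e' [k [E1 E2 H]]]]]].
have /ple_eqv[ab _] := (chang_mk_eq (a, b) (a', b')).1 E1.
have /ple_eqv[_ ce] := (chang_mk_eq (c, e) (c', e')).1 E2.
have ac : ple (a', b') (c', e') by rewrite /ple -!clD sle_cl; exists k.
by have := ple_trans (ple_trans ab ac) ce; rewrite /ple -!clD sle_cl.
Qed.

(** Sums distribute over joins of good sequences, so leastness splits by [stable_le_join] into two
    inequalities, from which [e] and [b] respectively cancel. *)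
Lemma chang_joinP a b c e :
  is_join (@chang_le d L) (chang_mk a b) (chang_mk c e)
    (chang_mk ((a +M e) `|` (b +M c)) (b +M e)).
Proof.
have J1 := le_stable (leUl (a +M e) (b +M c)).
have J2 := le_stable (leUr (b +M c) (a +M e)).
move: J1 J2; rewrite -!sle_cl => J1 J2.
split; rewrite ?chang_leE /ple /=.
- by rewrite clD GRing.addrCA sle_add2l -clD.
- by rewrite clD GRing.addrA GRing.addrC sle_add2l GRing.addrC -clD.
elim/chang_ind => f g; rewrite !chang_leE /ple /=.
rewrite -!clD !sle_cl good_join_add => fab gce.
apply: stable_le_join; rewrite -sle_cl !clD.
  by rewrite ![(_ + cl e + _)%R]GRing.addrAC sle_add2r -!clD sle_cl.
by rewrite -!GRing.addrA sle_add2l -!clD sle_cl.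
Qed.

Lemma chang_meetP a b c e :
  is_meet (@chang_le d L) (chang_mk a b) (chang_mk c e)
    (chang_mk ((a +M e) `&` (b +M c)) (b +M e)).
Proof.
have J1 := le_stable (leIl (a +M e) (b +M c)).
have J2 := le_stable (leIr (b +M c) (a +M e)).
move: J1 J2; rewrite -!sle_cl => J1 J2.
split; rewrite ?chang_leE /ple /=.
- by rewrite clD -GRing.addrA (GRing.addrC _ (cl b)) sle_add2l GRing.addrC -clD.
- by rewrite clD GRing.addrAC sle_add2r -clD.
elim/chang_ind => f g; rewrite !chang_leE /ple /=.
rewrite -!clD !sle_cl => fab fce.
rewrite (good_addC g) good_meet_add; apply: stable_le_meet; rewrite -sle_cl !clD.
  rewrite GRing.addrA (GRing.addrAC (cl a)) sle_add2r (GRing.addrC (cl a)).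
  by rewrite -!clD sle_cl.
rewrite GRing.addrCA -GRing.addrA sle_add2l (GRing.addrC (cl c)).
by rewrite -!clD sle_cl.
Qed.

Lemma chang_loag : lattice_ordered_abelian_group
  (@chang_add d L) (@chang_opp d L) (@chang_zero d L) (@chang_le d L).
Proof.
split.
- elim/chang_ind => a b; elim/chang_ind => a' b'; elim/chang_ind => c e.
  rewrite !chang_addE; apply/chang_mk_cl.
  by rewrite !clD GRing.addrC !GRing.addrA.
- elim/chang_ind => a b; elim/chang_ind => c e.
  by rewrite !chang_addE (good_addC a) (good_addC b).
- by elim/chang_ind => a b; rewrite chang_addE !good_add0x.
- elim/chang_ind => a b; rewrite chang_oppE chang_addE.
  by apply/chang_mk_cl; rewrite (good_addC a).
- by elim/chang_ind => a b; apply/chang_leE/ple_refl.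
- elim/chang_ind => a b; elim/chang_ind => c e /chang_leE ac /chang_leE ca.
  by apply/(chang_mk_eq (_, _) (_, _))/ple_eqv.
- elim/chang_ind => a b; elim/chang_ind => a' b'; elim/chang_ind => c e.
  by rewrite !chang_leE; apply: ple_trans.
- elim/chang_ind => a b; elim/chang_ind => a' b'; elim/chang_ind => c e.
  rewrite !chang_addE !chang_leE /ple /fst /snd !clD.
  rewrite (GRing.addrACA (cl a)) (GRing.addrACA (cl b)) (GRing.addrC (cl e)).
  by rewrite sle_add2r.
- by elim/chang_ind => a b; elim/chang_ind => c e; eexists; apply: chang_joinP.
- by elim/chang_ind => a b; elim/chang_ind => c e; eexists; apply: chang_meetP.
Qed.

End Transfer.

Theorem theorem5p4 (disp : Order.disp_t) (L : blAlgType disp) :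
  [/\ (forall p : good L * good L, chang_eqv p p),
      (forall p q : good L * good L, chang_eqv p q -> chang_eqv q p) &
      (forall p q r : good L * good L,
          chang_eqv p q -> chang_eqv q r -> chang_eqv p r)] /\
  [/\ (forall a b c d : good L,
          chang_mk a b = chang_mk c d <-> chang_eqv (a, b) (c, d)),
      (forall a b c d : good L,
          chang_add (chang_mk a b) (chang_mk c d) =
          chang_mk (a +M c) (b +M d)),
      (forall a b : good L, chang_opp (chang_mk a b) = chang_mk b a) &
      (forall a b c d : good L,
          chang_le (chang_mk a b) (chang_mk c d) <->
          exists k : good L, a +M d +M k <= b +M c +M k)] /\
  lattice_ordered_abelian_group
    (@chang_add disp L) (@chang_opp disp L) (@chang_zero disp L)
    (@chang_le disp L) /\
  (forall a b c d : good L,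
      is_join (@chang_le disp L) (chang_mk a b) (chang_mk c d)
        (chang_mk ((a +M d) `|` (b +M c)) (b +M d)) /\
      is_meet (@chang_le disp L) (chang_mk a b) (chang_mk c d)
        (chang_mk ((a +M d) `&` (b +M c)) (b +M d))).
Proof.
split; last split; last split.
- by split; [apply: chang_eqv_refl|apply: chang_eqv_sym|apply: chang_eqv_trans].
- split; [|exact: chang_addE|exact: chang_oppE|].
    by move=> a b c d; apply: (chang_mk_eq (a, b) (c, d)).
  by move=> a b c d; rewrite chang_leE /ple -!clD sle_cl.
- exact: chang_loag.
- by move=> a b c d; split; [apply: chang_joinP|apply: chang_meetP].
Qed.
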